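(* Let $G=(V,E)$ be a locally finite connected weighted graph with measure $\mu\ge\mu_0>0$, let $p\ge2$, $h:V\to\mathbb{R}$, $F:V\times\mathbb{R}\to\mathbb{R}$, and $e\in L^{\frac{p}{p-1}}(V)$ with $e\not\equiv0$. Assume: (h1) there is a constant $h_0>0$ such that $h(x)\ge h_0$ for all $x\in V$; (h2') for every constant $B>0$, $\sum_{x\in A_B}\mu(x)<\infty$, where $A_B=\{x\in V:h(x)\le B\}$; (f0) $F(x,s)$ is continuously differentiable in $s\in\mathbb{R}$ for all $x\in V$, and there are a continuous function $a:[0,\infty)\to[0,\infty)$ and $b:V\to[0,\infty)$ with $b\in L^1(V)$ such that $|F_s(x,s)|\le a(|s|)b(x)$ and $|F(x,s)|\le a(|s|)b(x)$ for all $x\in V$, $s\in\mathbb{R}$; (c1) $F(x,0)=0$ for all $x\in V$, and there is $l_0>0$ such that $|F_s(x,s)|\le\frac{h_0}{p+1}|s|^{p-1}$ for all $x\in V$ and all $s\in\mathbb{R}$ with $|s|<l_0$; (c2) there are $l_1>0$, some $x_2\in V$ with $e(x_2)>0$ and a constant $M$ such that $F(x_2,s)\ge Ms^p$ for all $s>l_1$, where $$M>\frac{D_1+\mu(x_2)h(x_2)}{p\mu(x_2)},\qquad D_1=\left(\frac{\deg(x_2)}{2}\right)^{\frac p2}\left(\sum_{x\sim x_2}\left(\frac{1}{\mu(x)}\right)^{\frac p2-1}+\left(\frac{1}{\mu(x_2)}\right)^{\frac p2-1}\right);$$ (c3) there are $\nu>p$ and $0\le A<h_0\left(\frac{\nu}{p}-1\right)$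 such that $\nu F(x,s)-F_s(x,s)s\le A|s|^p$ for all $x\in V$ and all $s\in\mathbb{R}$. Put $$\epsilon_0=\frac{\left(\min\left\{l_0(h_0\mu_0)^{\frac1p},1\right\}\right)^{p-1}}{(p+1)h_0^{-\frac1p}\|e\|_{L^{\frac{p}{p-1}}(V)}}.$$ Then for each $\epsilon\in(0,\epsilon_0)$ the equation $$-\Delta_pu+h(x)|u|^{p-2}u=F_u(x,u)+\epsilon e(x),\qquad x\in V,$$ has a nontrivial solution of positive energy. Furthermore, if in addition (c4) there are $l_2>0$, $\beta_3>1$, $K_3:V\to\mathbb{R}$ and some $x_3\in\{x\in V:e(x)>0\}$ with $K_3(x_3)>0$ such that $F(x_3,s)\ge K_3(x_3)|s|^{\beta_3}$ for all $s\in\mathbb{R}$ with $0<s<l_2$, then for each $\epsilon\in(0,\epsilon_0)$ the equation has another nontrivial solution of negative energy.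
   Context: Graph setting: $G=(V,E)$ is locally finite (each vertex lies on finitely many edges) and connected; each edge $xy\in E$ has a weight $\omega_{xy}=\omega_{yx}>0$; $y\sim x$ means $xy\in E$; $\deg(x)=\sum_{y\sim x}\omega_{xy}$; $\mu:V\to(0,\infty)$ satisfies $\mu(x)\ge\mu_0>0$ for all $x$. Write $\int_V u\,d\mu=\sum_{x\in V}u(x)\mu(x)$, $\|u\|_{L^r(V)}=(\int_V|u|^rd\mu)^{1/r}$, and $L^r(V)$ for the set of $u:V\to\mathbb{R}$ with $\|u\|_{L^r(V)}<\infty$. For $u:V\to\mathbb{R}$: $|\nabla u|(x)=\left(\frac{1}{2\mu(x)}\sum_{y\sim x}\omega_{xy}(u(y)-u(x))^2\right)^{1/2}$ and, for $p\ge2$ (with $|\cdot|^0=1$ if $p=2$), $$\Delta_pu(x)=\frac{1}{2\mu(x)}\sum_{y\sim x}\left(|\nabla u|^{p-2}(y)+|\nabla u|^{p-2}(x)\right)\omega_{xy}(u(y)-u(x)).$$ $C_c(V)$ is the set of finitely supported functions on $V$; $W^{1,p}(V)$ is the completion of $C_c(V)$ under $\left(\int_V|\nabla u|^p+|u|^pd\mu\right)^{1/p}$ (a space of functions on $V$), and $W_h^{1,p}(V)=\{u\in W^{1,p}(V):\int_Vh|u|^pd\mu<\infty\}$ with norm $\left(\int_V|\nabla u|^p+h|u|^pd\mu\right)^{1/p}$. A solution is a function $u\in W_h^{1,p}(V)$ satisfying the equation at every $x\in V$; nontrivial means $u\ne0$. The energy of $u$ is $$\frac1p\int_V(|\nabla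 u|^p+h|u|^p)d\mu-\int_VF(x,u)d\mu-\epsilon\int_Ve\,u\,d\mu.$$ $F_u$ (also $F_s$) is the partial derivative of $F$ in its second variable. *)

(* Defs.v *)
From mathcomp Require Export all_boot all_order all_algebra.
From mathcomp Require Export all_classical all_reals all_analysis.
Export Order.TTheory GRing.Theory Num.Theory.
Export numFieldNormedType.Exports.

Set Implicit Arguments.
Unset Strict Implicit.
Unset Printing Implicit Defensive.

Global Open Scope classical_set_scope.
Global Open Scope ring_scope.

(* [adj x y] is y ~ x. The values of [weight] outside the edges are irrelevant.
   Loops are not excluded. *)
Record wgraph (R : realType) (V : choiceType) := WGraph {
  adj : rel V ;
  weight : V -> V -> R ;
  meas : V -> R ;
  adj_sym : forall x y, adj x y = adj y x ;
  weight_sym : forall x y, adj x y -> weight x y = weight y x ;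
  weight_gt0 : forall x y, adj x y -> 0 < weight x y ;
  meas_gt0 : forall x, 0 < meas x }.

Definition nbhd (R : realType) (V : choiceType) (G : wgraph R V) (x : V) : set V :=
  [set y | adj G x y].

Definition locally_finite (R : realType) (V : choiceType) (G : wgraph R V) :=
  forall x, finite_set (nbhd G x).

Definition graph_connected (R : realType) (V : choiceType) (G : wgraph R V) :=
  forall x y, exists s : seq V, path (adj G) x s /\ last x s = y.

Definition deg (R : realType) (V : choiceType) (G : wgraph R V) (x : V) : R :=
  \sum_(y \in nbhd G x) weight G x y.

(* The integral of u over V against the measure. It is a finite number exactly
   when the sum converges absolutely (in \bar R, +oo - +oo = -oo). *)
Definition vint (R : realType) (V : choiceType) (G : wgraph R V) (u : V -> R) :
    \bar R :=
  (\esum_(x in [set: V]) (u^\+ x * meas G x)%:E -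
   \esum_(x in [set: V]) (u^\- x * meas G x)%:E)%E.

Definition vnorm (R : realType) (V : choiceType) (G : wgraph R V) (r : R)
    (u : V -> R) : \bar R :=
  poweR (vint G (fun x => `|u x| `^ r)) r^-1.

Definition in_L (R : realType) (V : choiceType) (G : wgraph R V) (r : R)
    (u : V -> R) : Prop :=
  (vnorm G r u < +oo)%E.

Definition gradn (R : realType) (V : choiceType) (G : wgraph R V) (u : V -> R)
    (x : V) : R :=
  Num.sqrt ((2 * meas G x)^-1 *
            \sum_(y \in nbhd G x) (weight G x y * (u y - u x) ^+ 2)).

(* Since 0 `^ 0 = 1, the convention |.|^0 = 1 holds when p = 2. *)
Definition plaplacian (R : realType) (V : choiceType) (G : wgraph R V) (p : R)
    (u : V -> R) (x : V) : R :=
  (2 * meas G x)^-1 *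
  \sum_(y \in nbhd G x)
    ((gradn G u y `^ (p - 2) + gradn G u x `^ (p - 2)) *
     weight G x y * (u y - u x)).

Definition in_Cc (R : realType) (V : choiceType) (u : V -> R) : Prop :=
  finite_set [set x | u x != 0].

Definition W1p_norm (R : realType) (V : choiceType) (G : wgraph R V) (p : R)
    (u : V -> R) : \bar R :=
  poweR (vint G (fun x => gradn G u x `^ p + `|u x| `^ p)) p^-1.

(* The completion of C_c(V), realized as a space of functions: the measure being
   bounded below, a Cauchy sequence converges pointwise, and its class is
   identified with its pointwise limit. *)
Definition in_W1p (R : realType) (V : choiceType) (G : wgraph R V) (p : R)
    (u : V -> R) : Prop :=
  exists phi : nat -> V -> R,
    [/\ forall n, in_Cc (phi n),
        forall d : R, 0 < d -> exists N : nat, forall m n : nat,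
          (N <= m)%N -> (N <= n)%N ->
          (W1p_norm G p (fun x => (phi m x - phi n x)%R) < d%:E)%E
      & forall x, phi n x @[n --> \oo] --> u x].

Definition in_W1ph (R : realType) (V : choiceType) (G : wgraph R V) (p : R)
    (h : V -> R) (u : V -> R) : Prop :=
  in_W1p G p u /\ (vint G (fun x => (h x * `|u x| `^ p)%R) < +oo)%E.

(* F_s, the partial derivative of F in its second variable. *)
Definition dF (R : realType) (V : choiceType) (F : V -> R -> R) (x : V) (s : R) : R :=
  derive1 (F x) s.

Definition is_solution (R : realType) (V : choiceType) (G : wgraph R V) (p : R)
    (h : V -> R) (F : V -> R -> R) (eps : R) (e : V -> R) (u : V -> R) : Prop :=
  in_W1ph G p h u /\
  forall x, - plaplacian G p u x + h x * `|u x| `^ (p - 2) * u x =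
            dF F x (u x) + eps * e x.

Definition energy (R : realType) (V : choiceType) (G : wgraph R V) (p : R)
    (h : V -> R) (F : V -> R -> R) (eps : R) (e : V -> R) (u : V -> R) : \bar R :=
  (p^-1%:E * vint G (fun x => (gradn G u x `^ p + h x * `|u x| `^ p)%R)
   - vint G (fun x => F x (u x))
   - eps%:E * vint G (fun x => (e x * u x)%R))%E.

Definition D1 (R : realType) (V : choiceType) (G : wgraph R V) (p : R) (x2 : V) : R :=
  (deg G x2 / 2) `^ (p / 2) *
  (\sum_(x \in nbhd G x2) ((meas G x)^-1 `^ (p / 2 - 1)) +
   (meas G x2)^-1 `^ (p / 2 - 1)).

Definition epsilon0 (R : realType) (V : choiceType) (G : wgraph R V)
    (p mu0 h0 l0 : R) (e : V -> R) : R :=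
  Num.min (l0 * (h0 * mu0) `^ p^-1) 1 `^ (p - 1) /
  ((p + 1) * h0 `^ (- p^-1) * fine (vnorm G (p / (p - 1)) e)).

(* Main.v *)
Require Import Defs.
From mathcomp Require Import ring lra finmap.

(* Solve first the Dirichlet problem on each finite set [Z] of vertices: the
   energy restricted to functions supported in [Z] is a C^1 function of finitely
   many real variables. It is bounded below by a positive constant on the sphere
   of radius [r0] (this is where [epsilon0] comes from) and is nonpositive at a
   far multiple of the Dirac function of [x2], so the mountain pass theorem gives a
   critical point at a level in [[al, C]], with [0 < al] and [C] independent of
   [Z]; under (c4), minimizing over the ball of radius [r0] gives a critical point
   at a level below a negative constant independent of [Z].

   By (c3) these critical points are bounded uniformly in [Z]; let [u] be their
   pointwise limit along an ultrafilter on the finite sets. By local finiteness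
   the equation at a vertex involves finitely many values, so [u] satisfies it.
   Testing the equation of [u] against the approximations, and the equations of
   the approximations against themselves, shows that the norms converge to the
   norm of [u], the nonlinear terms being dominated by [b] in L^1. Hence the
   energies converge and so do the approximations in norm, which puts [u] in the
   closure of C_c(V). *)

Set Implicit Arguments.
Unset Strict Implicit.
Unset Printing Implicit Defensive.

(** * A mountain pass theorem in finite dimension *)

(** The derivative of [F] in [s] is merely continuous, so the gradient of a finite-dimensional
    energy need not be Lipschitz and may have no flow to deform paths with. Descent is discrete
    instead: one continuous map [T] is iterated along the segment from 0 to the far multiple of the
    Dirac function. Continuity of [T] lets the intermediate value theorem find the sphere on every
    iterate of the segment, and a quantified decrease of the energy excludes an infinite orbit at
    levels in [[al, C]]. The minimax value itself is never formed.

    The danger in the limit is that part of the norm escapes to infinity along the graph, which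
    would leave the sign of the limit energy undecided. The lower-order terms cannot escape: since
    the measure is at least [mu0], a norm bound is a sup bound, so [F] and [dF] are dominated by
    multiples of [b], and Young's inequality handles [e]. The equations then transfer this to the
    norm.

    Powers of [|u|] and of the gradient are written as powers, with exponent derived from
    [p / 2 >= 1], of their squares, which are polynomial along lines; this settles differentiability
    at zeros. *)

(** Let [D u] consist of the radii [s <= 1] such that [g] oscillates by at most [eta] on the ball of
    radius [s] about [u]. That ball contains the one of radius [s - |u - v|] about [v], so
    [sup (D u)] is 1-Lipschitz in [u]. Half of it is strictly below the supremum, hence below some
    admissible radius. *)
Lemma continuity_radius (R : realType) (E F : normedModType R) (g : E -> F)
    (eta : R) :
  continuous g -> 0 < eta ->
  exists r : E -> R, [/\ continuous r, forall u, 0 < r u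
    & forall u w, `|w - u| <= r u -> `|g w - g u| <= eta].
Proof.
move=> cg eta0.
pose D u := [set s : R | 0 <= s <= 1 /\ forall w w', `|w - u| <= s ->
  `|w' - u| <= s -> `|g w - g w'| <= eta].
have D0 u : D u 0.
  split=> [|w w']; first by rewrite lexx ler01.
  by rewrite !normr_le0 !subr_eq0 => /eqP -> /eqP ->; rewrite subrr normr0 ltW.
have Dub u : has_ubound (D u) by exists 1 => s [/andP[]].
have Dsup u : has_sup (D u) by split => //; exists 0.
have Dle u s : D u s -> s <= sup (D u) by move=> Ds; apply: ub_le_sup.
have Dlip u v : sup (D u) <= sup (D v) + `|u - v|.
  apply: ge_sup; first by exists 0.
  move=> s [/andP[s0 s1] Hs]; rewrite -lerBlDr.
  have [suv|suv] := leP (s - `|u - v|) 0.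
    by apply: le_trans suv _; exact: Dle.
  apply: Dle; split.
    rewrite (ltW suv) /=; apply: le_trans s1; rewrite gerBl //.
  have tri w : `|w - v| <= s - `|u - v| -> `|w - u| <= s.
    move=> H; have -> : w - u = (w - v) - (u - v) by rewrite opprB addrA subrK.
    by apply: le_trans (ler_normB _ _) _; rewrite -lerBrDr.
  by move=> w w' /tri Hw /tri Hw'; exact: Hs.
have Dpos u : 0 < sup (D u).
  have /cvgrPdist_lt/(_ (eta / 2)) := cg u.
  rewrite divr_gt0 // => /(_ isT) /nbhs_ballP[d /= d0 Hd].
  have m0 : 0 < Num.min (d / 2) 1 by rewrite lt_min ltr01 divr_gt0.
  apply: (lt_le_trans m0); apply: Dle; split.
    by rewrite (ltW m0) ge_min lexx orbT.
  have H w : `|w - u| <= Num.min (d / 2) 1 -> `|g u - g w| < eta / 2.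
    move=> Hw; apply: Hd; rewrite -ball_normE /= distrC (le_lt_trans Hw) //.
    by rewrite gt_min; apply/orP; left; rewrite ltr_pdivrMr // ltr_pMr // ltr1n.
  move=> w w' /H Hw /H Hw'.
  have -> : g w - g w' = (g u - g w') - (g u - g w).
    by rewrite opprB [RHS]addrC subrKA.
  by rewrite (le_trans (ler_normB _ _)) // (splitr eta) lerD // ltW.
exists (fun u => sup (D u) / 2); split.
- move=> u; apply/cvgrPdist_le => e e0; near=> v.
  have uv : `|u - v| <= e.
    by near: v; apply: (@cvgr_dist_le _ _ _ (nbhs u) _ id).
  have H1 := Dlip u v; have := Dlip v u; rewrite distrC => H2.
  rewrite -mulrBl normrM (ger0_norm (_ : 0 <= 2^-1)) // ler_pdivrMr //.
  have e2 : e <= e * 2 by lra.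
  apply: le_trans e2; apply: le_trans uv.
  by rewrite ler_norml; apply/andP; split; lra.
- by move=> u; rewrite divr_gt0.
- move=> u w Hw.
  have [s Ds lts] : exists2 s, D u s & sup (D u) / 2 < s.
    by apply: sup_gt => //; [exact: (ex_intro _ 0) |have := Dpos u; lra].
  have [/andP[s0 _] H] := Ds.
  apply: H; first by apply: le_trans Hw _; exact: ltW.
  by rewrite subrr normr0.
Unshelve. all: by end_near. Qed.

(* The step lengths are summable, so the orbit converges, and [r] vanishes at
   its limit. *)
Lemma no_descent_orbit (R : realType) n (u : nat -> 'rV[R]_n)
    (r : 'rV[R]_n -> R) (f : nat -> R) (eta al : R) :
  continuous r -> (forall v, 0 < r v) -> 0 < eta ->
  (forall k, `|u k.+1 - u k| <= r (u k)) ->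
  (forall k, eta * r (u k) <= f k - f k.+1) ->
  (forall k, al <= f k) -> False.
Proof.
move=> cr r0 eta0 ur fr fal.
have rf k : r (u k) <= eta^-1 * (f k - f k.+1) by rewrite ler_pdivlMl.
have fdec : nonincreasing_seq f.
  apply/nonincreasing_seqP => k; rewrite -subr_ge0; apply: le_trans (fr k).
  by rewrite mulr_ge0 // ltW.
have ulip m k : `|u (m + k)%N - u m| <= eta^-1 * (f m - f (m + k)%N).
  elim: k => [|k IH]; first by rewrite addn0 !subrr normr0 mulr0.
  rewrite addnS -(subrKA (u (m + k)%N)) (le_trans (ler_normD _ _)) //.
  have := le_trans (ur (m + k)%N) (rf (m + k)%N).
  rewrite !mulrBr in IH *; lra.
have cvf : cvgn f.
  by apply: nonincreasing_is_cvgn => //; exists al => _ [k _ <-].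
have cvf0 : f n - f n.+1 @[n --> \oo] --> (0 : R).
  rewrite -(subrr (limn f)); apply: cvgB => //.
  by rewrite -(cvg_shiftS f) in cvf *.
have cvu : cvgn u.
  apply/cauchy_cvgP; apply: cauchy_exP => e e0.
  have /cvgrPdist_lt/(_ (eta * e)) := cvf.
  rewrite mulr_gt0 // => /(_ isT) [m _ Hm].
  exists (u m); exists m => // k /= mk; rewrite -ball_normE /= distrC.
  have := ulip m (k - m)%N; rewrite subnKC // => /le_lt_trans; apply.
  rewrite ltr_pdivrMl //.
  have := Hm m (leqnn m) => /= H1.
  have lk := nonincreasing_cvgn_ge fdec cvf k.
  apply: le_lt_trans H1; rewrite distrC ger0_norm; first by rewrite lerD2l lerN2.
  by rewrite subr_ge0; exact: nonincreasing_cvgn_ge.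
have cvr : r (u n) @[n --> \oo] --> r (limn u).
  by apply: continuous_cvg => //; exact: cr.
have : r (limn u) <= eta^-1 * 0.
  by apply: (ler_cvg_to cvr (cvgM (cvg_cst _) cvf0)); apply: nearW.
by rewrite mulr0 leNgt r0.
Qed.

(* The path [k |-> T^k (t w)] crosses the level set [N = rho] for every [k];
   the crossing parameters accumulate at a [t] whose whole orbit stays above [al]. *)
Lemma iter_barrier (R : realType) (E : normedModType R) (T : E -> E)
    (phi N : E -> R) (w : E) (rho al : R) :
  continuous T -> continuous phi -> continuous N ->
  T 0 = 0 -> T w = w -> N 0 < rho -> rho < N w ->
  (forall u, phi (T u) <= phi u) -> (forall u, N u = rho -> al <= phi u) ->
  exists2 t : R, 0 <= t <= 1 & forall k, al <= phi (iter k T (t *: w)).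
Proof.
move=> cT cphi cN T0 Tw N0 Nw phiT Nphi.
have cit k : continuous (fun t : R => iter k T (t *: w)).
  elim: k => [|k IH] t /=; first exact: scalel_continuous.
  by apply: continuous_comp; [exact: IH|exact: cT].
(* [T] fixes both ends of the segment, so every iterate of the path still starts below the level
   [rho] of [N] and ends above it. *)
have ex k : exists t : R, 0 <= t <= 1 /\ al <= phi (iter k T (t *: w)).
  have i0 : iter k T 0 = 0 by elim: (k) => //= j ->.
  have iw : iter k T w = w by elim: (k) => //= j ->.
  have [||t] := @IVT R (fun t => N (iter k T (t *: w))) 0 1 rho ler01.
  - apply: continuous_subspaceT => t.
    by apply: (@continuous_comp _ _ _ (fun t : R => iter k T (t *: w)) N);
      [exact: cit|exact: cN].
  - rewrite scale0r scale1r i0 iw min_l ?max_r ?(ltW N0) ?(ltW Nw) //;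
      by rewrite ltW // (lt_trans N0).
  by rewrite in_itv /= => t01 Nt; exists t; split => //; exact: Nphi.
pose t_ k := projT1 (cid (ex k)).
have t01 k : 0 <= t_ k <= 1 by have [] := projT2 (cid (ex k)).
have tal k : al <= phi (iter k T (t_ k *: w)) by have [] := projT2 (cid (ex k)).
have mono j k u : (j <= k)%N -> phi (iter k T u) <= phi (iter j T u).
  move=> /subnKC <-; elim: (k - j)%N => [|i IH]; first by rewrite addn0.
  by rewrite addnS /=; apply: le_trans IH.
have [] := @segment_compact R 0 1 (t_ @ \oo).
  by exists 0%N => // k _ /=; rewrite in_itv /= t01.
move=> t [/= t01' clt]; exists t; first by move: t01'; rewrite in_itv.
(* If the orbit of [t] were below [al] at time [j], so would be that of a nearby [t_ k] with
   [j <= k]; but [phi] does not increase along orbits, and the orbit of [t_ k] is still at least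
   [al] at time [k]. *)
move=> j; rewrite leNgt; apply/negP => lt_al.
have nb : nbhs t [set s : R | phi (iter j T (s *: w)) < al].
  have : continuous (fun s : R => phi (iter j T (s *: w))).
    by move=> s; apply: (@continuous_comp _ _ _ (fun t : R => iter j T (t *: w)) phi);
      [exact: cit|exact: cphi].
  by move=> /(_ t) /cvgr_lt; apply.
have tl : (t_ @ \oo) [set s | exists2 k, (j <= k)%N & s = t_ k].
  by exists j => // k jk; exists k.
have [_ [[k jk ->] /=]] := clt _ _ tl nb.
rewrite ltNge => /negP; apply; apply: le_trans (tal k) _; exact: mono.
Unshelve. all: by end_near. Qed.

Definition clamp (R : realType) (s : R) : R := Num.min 1 (Num.max 0 s).

Lemma clamp_continuous (R : realType) : continuous (@clamp R).
Proof.
move=> s; rewrite /clamp.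
apply: (@continuous_min R R (fun=> 1) (fun t => Num.max 0 t)); first exact: cvg_cst.
apply: (@continuous_max R R (fun=> 0) id); first exact: cvg_cst.
exact: cvg_id.
Qed.

Lemma clamp_ge0 (R : realType) (s : R) : 0 <= clamp s.
Proof. by rewrite le_min ler01 le_max lexx. Qed.

Lemma clamp_le1 (R : realType) (s : R) : clamp s <= 1.
Proof. by rewrite ge_min lexx. Qed.

Lemma clamp0 (R : realType) (s : R) : s <= 0 -> clamp s = 0.
Proof. by move=> s0; rewrite /clamp (max_l s0) min_r. Qed.

Lemma clamp1 (R : realType) (s : R) : 1 <= s -> clamp s = 1.
Proof. by move=> s1; rewrite /clamp max_r ?min_l // (le_trans ler01). Qed.

(** A continuous substitute for the sign: 0 on [[-1, 1]] and equal to the sign where [|s| >= 2]. The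
    dead zone has half-width 1 so that, wherever the value is nonzero, every [y] within distance 1
    of [s] has the sign of [s]. *)
Definition soft_sign (R : realType) (s : R) : R := clamp (s - 1) - clamp (- s - 1).

Lemma soft_sign_continuous (R : realType) : continuous (@soft_sign R).
Proof.
move=> s; apply: cvgB.
  apply: (@continuous_comp _ _ _ (fun s : R => s - 1) (@clamp R)); last exact: clamp_continuous.
  by apply: cvgB; [exact: cvg_id|exact: cvg_cst].
apply: (@continuous_comp _ _ _ (fun s : R => - s - 1) (@clamp R)); last exact: clamp_continuous.
by apply: cvgB; [apply: cvgN; exact: cvg_id|exact: cvg_cst].
Qed.

Lemma soft_sign_norm (R : realType) (s : R) : `|soft_sign s| <= 1.
Proof.
rewrite /soft_sign ler_norml.
have := clamp_ge0 (s - 1); have := clamp_le1 (s - 1).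
have := clamp_ge0 (- s - 1); have := clamp_le1 (- s - 1).
by move=> ? ? ? ?; apply/andP; split; lra.
Qed.

Lemma soft_sign_mul_ge0 (R : realType) (s y : R) :
  `|y - s| <= 1 -> 0 <= y * soft_sign s.
Proof.
rewrite /soft_sign ler_norml => /andP[H1 H2].
have := clamp_ge0 (s - 1); have := clamp_ge0 (- s - 1) => G1 G2.
have [s1|s1] := leP s 1; last by rewrite (clamp0 (_ : - s - 1 <= 0)); nra.
rewrite (clamp0 (_ : s - 1 <= 0)); last lra.
have [s2|s2] := leP (-1) s; last by nra.
by rewrite (clamp0 (_ : - s - 1 <= 0)) ?subr0 ?mulr0 //; lra.
Qed.

Lemma soft_sign_mul_ge1 (R : realType) (s y : R) :
  `|y - s| <= 1 -> 2 <= `|s| -> 1 <= y * soft_sign s.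
Proof.
rewrite /soft_sign ler_norml => /andP[H1 H2].
have [s0|s0] := leP 0 s; [rewrite ger0_norm //|rewrite ltr0_norm //] => s2.
  by rewrite (clamp0 (_ : - s - 1 <= 0)) ?(clamp1 (_ : 1 <= s - 1)); lra.
by rewrite (clamp0 (_ : s - 1 <= 0)) ?(clamp1 (_ : 1 <= - s - 1)); lra.
Qed.

Lemma norm_rV_le (R : realType) n (v : 'rV[R]_n) (c : R) :
  0 <= c -> (forall i, `|v ord0 i| <= c) -> `|v| <= c.
Proof.
move=> c0 H; rewrite [leLHS]/Num.norm /= mx_normrE; apply/bigmax_leP; split => //.
by move=> [i j] _ /=; rewrite ord1.
Qed.

Lemma norm_rV_ge (R : realType) n (v : 'rV[R]_n) i : `|v ord0 i| <= `|v|.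
Proof.
rewrite [leRHS]/Num.norm /= mx_normrE.
by apply: (le_bigmax _ (fun ij => `|v ij.1 ij.2|) (ord0, i)).
Qed.

Lemma rV_continuous (R : realType) (X : topologicalType) n (f : X -> 'rV[R]_n) :
  (forall i, continuous (fun x => f x ord0 i)) -> continuous f.
Proof.
move=> cf x; apply/cvgrPdist_le => e e0; near=> y.
apply: norm_rV_le; first exact: ltW.
move=> i; rewrite !mxE; move: i; near: y; apply: filter_forall => i.
by have /cvgrPdist_le := cf i x; apply.
Unshelve. all: by end_near. Qed.

Lemma continuous_step (R : realType) (X : topologicalType) (V : normedModType R)
    (a b : X -> R) (f g : X -> V) :
  continuous f -> continuous g -> continuous a -> continuous b ->
  continuous (fun x => f x + (a x * b x) *: g x).
Proof.
move=> cf cg ca cb x; apply: cvgD; first exact: cf.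
by apply: cvgZ; [apply: cvgM; [exact: ca|exact: cb]|exact: cg].
Qed.

Section MountainPass.
Variables (R : realType) (n : nat) (phi N : 'rV[R]_n -> R).
Variables (g : 'rV[R]_n -> 'rV[R]_n).
Hypothesis phi_cont : continuous phi.
Hypothesis N_cont : continuous N.
Hypothesis g_cont : continuous g.
Hypothesis phi_deriv : forall u v (t : R),
  is_derive t 1 (fun s : R => phi (u + s *: v))
    (\sum_i g (u + t *: v) ord0 i * v ord0 i).

(* In the sup norm, the coordinatewise sign of the gradient is a descent
   direction; its soft version is continuous. *)
Lemma descent_map (al C eta : R) :
  0 < al -> 0 < eta ->
  (forall u, al <= phi u <= C -> 2 * eta <= `|g u|) ->
  exists (T : 'rV[R]_n -> 'rV[R]_n) (r : 'rV[R]_n -> R),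
    [/\ continuous T, continuous r, forall u, 0 < r u,
        forall u, phi u <= 0 -> T u = u
      & [/\ forall u, phi (T u) <= phi u, forall u, `|T u - u| <= r u
          & forall u, al <= phi u <= C -> eta * r u <= phi u - phi (T u)]].
Proof.
move=> al0 eta0 Hg.
have [r [cr r0 rg]] := continuity_radius g_cont eta0.
(* The cutoff vanishes where [phi <= 0], which keeps the end points of the path fixed, and equals 1
   where [phi >= al]. *)
pose c u := clamp (phi u / al).
have c0 u : 0 <= c u by exact: clamp_ge0.
have c1 u : c u <= 1 by exact: clamp_le1.
have cc : continuous c.
  have ca : continuous (fun s : R => clamp (s / al)).
    move=> s; apply: (@continuous_comp _ _ _ (fun s : R => s / al) (@clamp R)).
      exact: mulrr_continuous.
    exact: clamp_continuous.
  by move=> u; apply: (@continuous_comp _ _ _ phi (fun s : R => clamp (s / al)));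
    [exact: phi_cont|exact: ca].
pose d u : 'rV[R]_n := \row_i - soft_sign (g u ord0 i / eta).
have cd : continuous d.
  have cs : continuous (fun s : R => - soft_sign (s / eta)).
    move=> s; apply: cvgN.
    apply: (@continuous_comp _ _ _ (fun s : R => s / eta) (@soft_sign R)).
      exact: mulrr_continuous.
    exact: soft_sign_continuous.
  apply: rV_continuous => i u.
  under eq_fun do rewrite mxE.
  apply: (@continuous_comp _ _ _ (fun u => g u ord0 i)
    (fun s : R => - soft_sign (s / eta))); last exact: cs.
  by apply: (@continuous_comp _ _ _ g (fun M : 'rV_n => M ord0 i));
    [exact: g_cont|exact: coord_continuous].
have d1 u : `|d u| <= 1.
  by apply: norm_rV_le => // i; rewrite mxE normrN soft_sign_norm.
pose st u := c u * r u.
have st0 u : 0 <= st u by rewrite mulr_ge0 // ltW.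
have str u : st u <= r u by rewrite ler_piMl // ltW.
(* During the whole step [g] moves by at most [eta], hence each [g_i / eta] by at most 1, as the
   soft sign tolerates. *)
have key u s : 0 <= s <= st u -> forall i,
    `|g (u + s *: d u) ord0 i / eta - g u ord0 i / eta| <= 1.
  move=> /andP[s0 s1] i; rewrite -mulrBl normrM normfV (gtr0_norm eta0).
  rewrite ler_pdivrMr // mul1r.
  have := rg u (u + s *: d u); rewrite addrC addKr normrZ (ger0_norm s0) => H.
  have /H{H} : s * `|d u| <= r u.
    by apply: le_trans (le_trans s1 (str u)); rewrite ler_piMr.
  move=> H; apply: le_trans H.
  have := norm_rV_ge (g (u + s *: d u) - g u) i.
  by rewrite !mxE.
have term u s i : 0 <= s <= st u ->
    g (u + s *: d u) ord0 i * d u ord0 i <= 0.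
  move=> /key /(_ i) /soft_sign_mul_ge0 H.
  by rewrite mxE mulrN oppr_le0 -[g _ _ _](divfK (lt0r_neq0 eta0)) mulrAC
    mulr_ge0 // ltW.
have der u : exists2 s, 0 <= s <= st u & phi (u + st u *: d u) - phi u =
    (\sum_i g (u + s *: d u) ord0 i * d u ord0 i) * st u.
  have [|s sI] := @MVT_segment R (fun s => phi (u + s *: d u))
      (fun s => \sum_i g (u + s *: d u) ord0 i * d u ord0 i) 0 (st u) (st0 u).
  - apply: continuous_subspaceT => t.
    apply: differentiable_continuous; apply/derivable1_diffP.
    by have [] := phi_deriv u (d u) t.
  rewrite scale0r addr0 subr0 => E; exists s => //.
have cT : continuous (fun u : 'rV[R]_n => u + st u *: d u).
  by apply: continuous_step => // u; exact: cvg_id.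
exists (fun u => u + st u *: d u), r; split => //.
- move=> u pu; rewrite /st /c.
  have pa : phi u / al <= 0 by rewrite pmulr_lle0 ?invr_gt0.
  by rewrite (clamp0 pa) mul0r scale0r addr0.
split=> [u|u|u pu].
- have [s s01 E] := der u.
  rewrite -subr_le0 E mulr_le0_ge0 //.
  by apply: sumr_le0 => i _; exact: term.
- by rewrite addrC addKr normrZ (ger0_norm (st0 u)) (le_trans _ (str u)) // ler_piMr.
- have [s s01 E] := der u.
  have cu : c u = 1.
    by apply: clamp1; have /andP[H _] := pu; rewrite ler_pdivlMr // mul1r.
  have st_r : st u = r u by rewrite /st cu mul1r.
  rewrite -opprB E st_r -mulNr ler_wpM2r //; first exact: ltW.
  (* In the sup norm a single coordinate carries the norm of [g u]. It alone yields a slope of at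
     most [- eta]; the other coordinates contribute nonpositive terms. *)
  have [i gi] : exists i, 2 * eta <= `|g u ord0 i|.
    apply/not_existsP => H.
    have := Hg u pu; rewrite leNgt => /negP; apply.
    rewrite [ltLHS]/Num.norm /= mx_normrE; apply/bigmax_ltP; split.
      by rewrite mulr_gt0.
    by move=> [i j] _ /=; rewrite ord1 ltNge; apply/negP; exact: H.
  rewrite (bigD1 i) //= opprD.
  have H1 : \sum_(j < n | j != i) g (u + s *: d u) ord0 j * d u ord0 j <= 0.
    by apply: sumr_le0 => j _; exact: term.
  have H2 : eta <= - (g (u + s *: d u) ord0 i * d u ord0 i).
    rewrite mxE mulrN opprK -[g (_ + _) _ _](divfK (lt0r_neq0 eta0)) mulrAC.
    rewrite ler_peMl ?(ltW eta0) //.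
    apply: soft_sign_mul_ge1; first exact: key.
    by rewrite normrM normfV (gtr0_norm eta0) ler_pdivlMr.
  lra.
Qed.

(** The last hypothesis is a finite-dimensional Palais-Smale condition: it makes the set of almost
    critical points with level in [[al, C]] compact. Without a critical point there, [|g|] has a
    positive lower bound on the whole strip, so [descent_map] applies; the orbit found by
    [iter_barrier] stays in the strip, which [no_descent_orbit] forbids. *)
Lemma mountain_pass (w : 'rV[R]_n) (rho al C sg K : R) :
  0 < al -> 0 < sg -> phi 0 <= 0 -> phi w <= 0 -> N 0 < rho -> rho < N w ->
  (forall u, N u = rho -> al <= phi u) ->
  (forall t, 0 <= t <= 1 -> phi (t *: w) <= C) ->
  (forall u, al <= phi u <= C -> `|g u| <= sg -> `|u| <= K) ->
  exists2 u, g u = 0 & al <= phi u <= C.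
Proof.
move=> al0 sg0 p0 pw N0 Nw Nal wC PS; apply: contrapT => noc.
have [eta eta0 Heta] : exists2 eta, 0 < eta &
    forall u, al <= phi u <= C -> 2 * eta <= `|g u|.
  pose A := [set u | al <= phi u <= C /\ `|g u| <= sg].
  have cng : continuous (fun u => `|g u|).
    by move=> u; apply: (@continuous_comp _ _ _ g (fun v => `|v|));
      [exact: g_cont|exact: norm_continuous].
  have clA : closed A.
    have -> : A = [set u | al <= phi u] `&` [set u | phi u <= C] `&`
        [set u | `|g u| <= sg].
      apply/seteqP; split=> u /=; first by move=> [/andP[h1 h2] h3].
      by move=> [[h1 h2] h3]; rewrite /A /= h1 h2.
    apply: closedI; first apply: closedI.
    - by apply: (@closed_comp _ _ phi [set x | al <= x]) => // x _; exact: phi_cont.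
    - by apply: (@closed_comp _ _ phi [set x | x <= C]) => // x _; exact: phi_cont.
    - by apply: (@closed_comp _ _ (fun u => `|g u|) [set x | x <= sg]) => // x _; exact: cng.
  have coA : compact A.
    apply: bounded_closed_compact => //; exists K; split; first exact: num_real.
    by move=> x Kx u [Hu1 Hu2]; apply: le_trans (ltW Kx); exact: PS.
  have [[u0 Au0]|A0] := pselect (A !=set0); last first.
    exists (sg / 2); first by rewrite divr_gt0.
    move=> u Hu; rewrite mulrC divfK // leNgt; apply/negP => gs.
    by apply: A0; exists u; split => //; exact: ltW.
  have [|c cA Hc] := EVT_min_rV (ex_intro _ u0 Au0) coA (f := fun u => `|g u|).
    by apply: continuous_subspaceT.
  have {}cA : A c := set_mem cA.
  have gc : 0 < `|g c|.
    rewrite normr_gt0; apply/eqP => gc0; apply: noc; exists c => //.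
    by have [] := cA.
  exists (`|g c| / 2); first by rewrite divr_gt0.
  move=> u Hu; rewrite mulrC divfK //.
  have [gs|gs] := leP `|g u| sg; first exact: Hc (mem_set (conj Hu gs)).
  by apply: le_trans (ltW gs); have [] := cA.
have [T [r [cT cr r0 Tfix [Tle Tr Teta]]]] := descent_map al0 eta0 Heta.
have [t t01 Ht] := iter_barrier cT phi_cont N_cont (Tfix _ p0) (Tfix _ pw)
  N0 Nw Tle Nal.
have HC k : phi (iter k T (t *: w)) <= C.
  elim: k => [|k IH]; first exact: wC.
  exact: le_trans (Tle _) IH.
apply: (@no_descent_orbit R n (fun k => iter k T (t *: w)) r
  (fun k => phi (iter k T (t *: w))) eta al) => // k.
  exact: Tr.
by apply: Teta; rewrite Ht HC.
Qed.

End MountainPass.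

(** * Real powers *)

(** The function [x]^ s[is treated by differentiability only at]l > 0[. At]l =
    0[the estimate is made by hand, and]s = 0[is separate because]0 [^ 0 = 1]. *)
Lemma cvg_powR (R : realType) (T : Type) (F : set_system T) (FF : ProperFilter F)
    (f : T -> R) (l s : R) :
  f x @[x --> F] --> l -> (forall x, 0 <= f x) -> 0 <= s ->
  f x `^ s @[x --> F] --> l `^ s.
Proof.
move=> fl f0; rewrite le_eqVlt => /predU1P[<-|s0].
  by under eq_fun do rewrite powRr0; rewrite powRr0; exact: cvg_cst.
have : 0 <= l by apply: (cvgr_to_ge fl); exact: nearW.
rewrite le_eqVlt => /predU1P[l0|l0].
  rewrite -l0 powR0 ?gt_eqF //; apply/cvgrPdist_lt => e e0.
  have e1 : 0 < e `^ s^-1 by rewrite powR_gt0.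
  have /cvgrPdist_lt/(_ _ e1) := fl; apply: filterS => x; rewrite -l0 !sub0r !normrN.
  rewrite !ger0_norm ?powR_ge0 // => H.
  have -> : e = (e `^ s^-1) `^ s by rewrite -powRrM mulVf ?gt_eqF // powRr1 // ltW.
  by apply: gt0_ltr_powR => //; rewrite nnegrE ?powR_ge0.
have cl : {for l, continuous (fun x : R => x `^ s)}; last exact: (cvg_comp _ _ fl cl).
apply: differentiable_continuous; apply/derivable1_diffP.
by apply: derivable_powR; rewrite in_itv /= l0.
Qed.

Lemma is_derive_powR_ge0 (R : realType) (q : R -> R) (t dq s : R) :
  (forall x, 0 <= q x) -> is_derive t 1 q dq -> 1 <= s ->
  is_derive t 1 (fun x => q x `^ s) (s * q t `^ (s - 1) * dq).
Proof.
move=> q0 dq_ s1.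
have [s_1|s1'] := eqVneq s 1.
  rewrite s_1 subrr powRr0 !mul1r.
  suff -> : (fun x => q x `^ 1) = q by [].
  by apply/funext => x; rewrite powRr1.
have s_gt1 : 1 < s by rewrite lt_neqAle eq_sym s1'.
have := q0 t; rewrite le_eqVlt => /predU1P[qt|qt]; last first.
  have H := is_derive1_powR s qt.
  exact: (is_derive1_comp H dq_).
have [/cvg_ex[l dl] dv] := dq_.
have cq : q (h *: 1 + t) @[h --> 0^'] --> 0.
  have cqt : continuous_at t q.
    apply: differentiable_continuous; apply/derivable1_diffP.
    by have [] := dq_.
  rewrite [X in _ --> X](_ : _ = q (0 *: 1 + t)); last by rewrite scale0r add0r -qt.
  apply: cvg_within_filter.
  apply: (@continuous_comp _ _ _ (fun h : R => h *: 1 + t) q); last first.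
    by rewrite scale0r add0r.
  apply: cvgD; last exact: cvg_cst.
  exact: scalel_continuous.
have lim0 : h^-1 *: (q (h *: 1 + t) `^ s - q t `^ s) @[h --> 0^'] --> (0 : R).
  rewrite -qt (powR0 (_ : s != 0)) ?gt_eqF ?(lt_trans ltr01) //.
  have -> : (fun h : R => h^-1 *: (q (h *: 1 + t) `^ s - 0)) =
      (fun h : R => (h^-1 *: (q (h *: 1 + t) - q t)) * q (h *: 1 + t) `^ (s - 1)).
    apply/funext => h; rewrite -qt !subr0 /GRing.scale /= -[RHS]mulrA.
    by rewrite mulr_powRB1 // (lt_trans ltr01).
  have c1 : q (h *: 1 + t) `^ (s - 1) @[h --> 0^'] --> (0 : R) `^ (s - 1).
    by apply: cvg_powR => //; rewrite subr_ge0.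
  have := cvgM dl c1; rewrite (powR0 (_ : s - 1 != 0)) ?subr_eq0 // mulr0.
  by move=> H; exact: H.
rewrite -qt (powR0 (_ : s - 1 != 0)) ?subr_eq0 // mulr0 mul0r.
split; first exact: cvgP lim0.
exact: cvg_lim lim0.
Qed.

Lemma powR_mul_le (R : realType) (a b s : R) : 0 <= a -> 0 <= b -> 1 <= s ->
  a `^ (s - 1) * b <= a `^ s + b `^ s.
Proof.
move=> a0 b0 s1; have s0 : 0 < s by apply: lt_le_trans s1.
have sm : 0 <= s - 1 by rewrite subr_ge0.
have [ba|ab] := leP b a.
  apply: (@le_trans _ _ (a `^ s)); last by rewrite lerDl powR_ge0.
  by rewrite -(mulr_powRB1 a0 s0) mulrC ler_wpM2r // powR_ge0.
apply: (@le_trans _ _ (b `^ s)); last by rewrite lerDr powR_ge0.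
by rewrite -(mulr_powRB1 b0 s0) mulrC ler_wpM2l // ge0_ler_powR // ?nnegrE // ltW.
Qed.

Lemma powRD_le (R : realType) (a b s : R) : 0 <= a -> 0 <= b -> 0 <= s ->
  (a + b) `^ s <= 2 `^ s * (a `^ s + b `^ s).
Proof.
move=> a0 b0 s0.
have H (x y : R) : 0 <= x -> x <= y -> (x + y) `^ s <= 2 `^ s * y `^ s.
  move=> x0 xy; have y0 := le_trans x0 xy.
  by rewrite -powRM // ge0_ler_powR // ?nnegrE; lra.
have p2 : 0 <= 2 `^ s :> R by exact: powR_ge0.
have [ba|/ltW ab] := leP b a.
  rewrite addrC (le_trans (H _ _ b0 ba)) // ler_wpM2l // lerDl powR_ge0 //.
by rewrite (le_trans (H _ _ a0 ab)) // ler_wpM2l // lerDr powR_ge0.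
Qed.

(* Either [a <= d b^(p-1)], or [b < (a/d)^(1/(p-1))]. *)
Lemma young_eps (R : realType) (p d : R) : 1 < p -> 0 < d ->
  exists2 C : R, 0 <= C & forall a b, 0 <= a -> 0 <= b ->
    a * b <= d * b `^ p + C * a `^ (p / (p - 1)).
Proof.
move=> p1 d0; have p0 : 0 < p by apply: lt_trans p1.
have pm : 0 < p - 1 by rewrite subr_gt0.
exists ((d^-1) `^ (p - 1)^-1); first exact: powR_ge0.
move=> a b a0 b0; have [ad|da] := leP a (d * b `^ (p - 1)).
  apply: (@le_trans _ _ (d * b `^ p)); last first.
    by rewrite lerDl mulr_ge0 // powR_ge0.
  by rewrite -(mulr_powRB1 b0 p0) mulrCA mulrC ler_wpM2l.
apply: (@le_trans _ _ ((d^-1) `^ (p - 1)^-1 * a `^ (p / (p - 1)))); last first.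
  by rewrite lerDr mulr_ge0 ?powR_ge0 // ltW.
have pp : p / (p - 1) - 1 = (p - 1)^-1 by field; rewrite gt_eqF.
rewrite -(mulr_powRB1 a0 (_ : 0 < p / (p - 1))) ?divr_gt0 // pp mulrCA ler_wpM2l //.
rewrite -powRM ?invr_ge0 ?(ltW d0) //.
have -> : b = (b `^ (p - 1)) `^ (p - 1)^-1 by rewrite -powRrM mulfV ?gt_eqF // powRr1.
rewrite ge0_ler_powR ?nnegrE ?powR_ge0 ?mulr_ge0 ?invr_ge0 ?(ltW pm) ?(ltW d0) //.
by rewrite ler_pdivlMl // ltW.
Qed.

(** Turns a bound on a [p]-th power into a bound on the number itself without extracting a root. *)
Lemma le1_add_powR (R : realType) (a p : R) : 0 <= a -> 1 <= p -> a <= 1 + a `^ p.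
Proof.
move=> a0 p1; have [a1|/ltW a1] := leP a 1.
  by rewrite (le_trans a1) // lerDl powR_ge0.
by rewrite (le_trans (le1r_powR a1 p1)) // lerDr.
Qed.

Lemma normX2_powR (R : realType) (a p : R) : `|a| `^ p = (a ^+ 2) `^ (p / 2).
Proof.
by rewrite -real_normK ?num_real // -powR_mulrn // -powRrM mulrCA mulfV ?mulr1.
Qed.

(** * Unconditional sums *)

(** Finite sets ordered by inclusion. Convergence of partial sums along this filter is unconditional
    summation, with no enumeration of [V], and the index set of the approximate solutions is the
    same. *)
Definition fin_filter (V : choiceType) : set_system {fset V} :=
  [set P | exists Q : {fset V}, forall S : {fset V}, (Q `<=` S)%fset -> P S].

#[global] Instance fin_filter_proper (V : choiceType) : ProperFilter (@fin_filter V).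
Proof.
apply: Build_ProperFilter_ex.
  by move=> P [Q HQ]; exists Q; exact: HQ.
split.
- by exists fset0.
- move=> P P' [Q HQ] [Q' HQ']; exists (Q `|` Q')%fset => S.
  by rewrite fsubUset => /andP[QS QS']; split; [exact: HQ|exact: HQ'].
- by move=> P P' PP' [Q HQ]; exists Q => S QS; exact/PP'/HQ.
Qed.

Lemma cvg_sumr (R : realType) (I J : Type) (U : set_system I) (FU : ProperFilter U)
    (l : seq J) (f : J -> I -> R) (f_ : J -> R) :
  (forall j, f j i @[i --> U] --> f_ j) ->
  \sum_(j <- l) f j i @[i --> U] --> \sum_(j <- l) f_ j.
Proof. by move=> H; apply: cvg_big => //; exact: add_continuous. Qed.

Lemma cvg_mulr_cst (R : realType) (I : Type) (U : set_system I) (FU : ProperFilter U)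
    (f : I -> R) (l c : R) :
  f i @[i --> U] --> l -> f i * c @[i --> U] --> l * c.
Proof. by move=> fl; apply: cvgM => //; exact: cvg_cst. Qed.

Lemma cvg_continuous (R : realType) (I : Type) (U : set_system I) (FU : ProperFilter U)
    (f : R -> R) (u : I -> R) (l : R) :
  continuous f -> u i @[i --> U] --> l -> f (u i) @[i --> U] --> f l.
Proof. by move=> cf cu; apply: continuous_cvg => //; exact: cf. Qed.

Section Sums.
Variables (R : realType) (V : choiceType).
Implicit Types (f g : V -> R) (S Q Z : {fset V}) (s C : R).

Definition psum f S : R := \sum_(x <- S) f x.

Definition has_sum f s := psum f S @[S --> @fin_filter V] --> s.

Lemma psum_le f g S : (forall x, f x <= g x) -> psum f S <= psum g S.
Proof. by move=> fg; apply: ler_sum. Qed.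

Lemma psum_ge0 f S : (forall x, 0 <= f x) -> 0 <= psum f S.
Proof. by move=> f0; apply: sumr_ge0. Qed.

Lemma psumD f g S : psum (fun x => f x + g x) S = psum f S + psum g S.
Proof. exact: big_split. Qed.

Lemma psumZ c f S : psum (fun x => c * f x) S = c * psum f S.
Proof. by rewrite /psum mulr_sumr. Qed.

Lemma psumN f S : psum (fun x => - f x) S = - psum f S.
Proof. exact: sumrN. Qed.

Lemma psum_norm f S : `|psum f S| <= psum (fun x => `|f x|) S.
Proof. exact: ler_norm_sum. Qed.

Lemma psum_extend f Z S : (Z `<=` S)%fset ->
  (forall x, x \notin Z -> f x = 0) -> psum f S = psum f Z.
Proof. by move=> ZS f0; rewrite /psum (big_fset_incl _ ZS) // => x _; exact: f0. Qed.

Lemma psum_split f Q S : psum f S = psum f (S `&` Q)%fset + psum f (S `\` Q)%fset.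
Proof.
rewrite /psum (big_fsetID _ (mem Q)) /=.
by congr (_ + _); apply: eq_fbigl => x; rewrite !inE // andbC.
Qed.

Lemma psum_subset f Q S : (forall x, 0 <= f x) -> (Q `<=` S)%fset ->
  psum f Q <= psum f S.
Proof.
move=> f0 QS; rewrite (psum_split f Q S) (fsetIidPr QS).
by rewrite lerDl psum_ge0.
Qed.

Lemma psum_mem f S x : (forall y, 0 <= f y) -> x \in S -> f x <= psum f S.
Proof.
move=> f0 xS; have := @psum_subset f [fset x]%fset S f0.
by rewrite fsub1set xS /psum big_seq_fset1; apply.
Qed.

Lemma has_sum_fin f Z : (forall x, x \notin Z -> f x = 0) -> has_sum f (psum f Z).
Proof.
move=> f0; apply: cvg_near_cst; exists Z => S ZS /=.
by rewrite (psum_extend ZS).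
Qed.

Lemma has_sum_unique f s s' : has_sum f s -> has_sum f s' -> s = s'.
Proof. by move=> H H'; apply: (cvg_unique _ H H'). Qed.

Lemma has_sumD f g s s' : has_sum f s -> has_sum g s' ->
  has_sum (fun x => f x + g x) (s + s').
Proof.
move=> Hf Hg; rewrite /has_sum (_ : psum _ = psum f \+ psum g); first exact: cvgD.
by apply/funext => S; exact: psumD.
Qed.

Lemma has_sumZ c f s : has_sum f s -> has_sum (fun x => c * f x) (c * s).
Proof.
move=> Hf; rewrite /has_sum (_ : psum _ = fun S => c * psum f S).
  by apply: cvgM => //; exact: cvg_cst.
by apply/funext => S; exact: psumZ.
Qed.

Lemma has_sumB f g s s' : has_sum f s -> has_sum g s' ->
  has_sum (fun x => f x - g x) (s - s').
Proof.
move=> Hf Hg; have := has_sumD Hf (@has_sumZ (-1) _ _ Hg).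
rewrite mulN1r; congr (has_sum _ _).
by apply/funext => x; rewrite mulN1r.
Qed.

Lemma has_sum_le f s C : has_sum f s -> (forall S, psum f S <= C) -> s <= C.
Proof. by move=> Hf H; apply: (cvgr_to_le Hf); exact: nearW. Qed.

Lemma psum_le_sum f s S : (forall x, 0 <= f x) -> has_sum f s -> psum f S <= s.
Proof.
move=> f0 Hf; apply: (cvgr_to_ge Hf); exists S => S' SS'.
exact: psum_subset.
Qed.

Lemma has_sum_ge0 f s : (forall x, 0 <= f x) -> has_sum f s -> 0 <= s.
Proof. by move=> f0 Hf; have := psum_le_sum fset0 f0 Hf; rewrite /psum big_seq_fset0. Qed.

Lemma has_sum_pos_exists f C : (forall x, 0 <= f x) -> (forall S, psum f S <= C) ->
  exists s, has_sum f s.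
Proof.
move=> f0 fC; pose A := range (psum f).
have hA : has_sup A by split; [exists (psum f fset0), fset0|exists C => _ [S _ <-]].
exists (sup A); apply/cvgrPdist_le => e e0.
have [_ [Q _ <-] ltQ] := sup_adherent e0 hA.
exists Q => S QS.
have H1 : psum f S <= sup A by apply: ub_le_sup; [case: hA|exists S].
have H2 := psum_subset f0 QS.
by rewrite ger0_norm ?subr_ge0 //; lra.
Qed.

Definition abs_bounded f := exists C, forall S, psum (fun x => `|f x|) S <= C.

Lemma abs_bounded_pos f : abs_bounded f ->
  exists s, has_sum (fun x => f^\+ x) s.
Proof.
move=> [C HC]; apply: (@has_sum_pos_exists _ C) => [x|S]; first exact: funrpos_ge0.
apply: le_trans (HC S); apply: psum_le => x.
by rewrite /funrpos ge_max ler_norm normr_ge0.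
Qed.

Lemma abs_bounded_neg f : abs_bounded f ->
  exists s, has_sum (fun x => f^\- x) s.
Proof.
move=> [C HC]; apply: (@has_sum_pos_exists _ C) => [x|S]; first exact: funrneg_ge0.
apply: le_trans (HC S); apply: psum_le => x.
by rewrite /funrneg ge_max normr_ge0 andbT -normrN ler_norm.
Qed.

Lemma abs_bounded_has_sum f : abs_bounded f -> exists s, has_sum f s.
Proof.
move=> Hf; have [s Hs] := abs_bounded_pos Hf; have [s' Hs'] := abs_bounded_neg Hf.
exists (s - s'); have := has_sumB Hs Hs'; congr (has_sum _ _).
exact: funrposBneg.
Qed.

Lemma abs_tail f d : abs_bounded f -> 0 < d ->
  exists Q, forall Z, [disjoint Q & Z]%fset -> psum (fun x => `|f x|) Z <= d.
Proof.
move=> [C HC] d0.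
have [s Hs] := @has_sum_pos_exists (fun x => `|f x|) C (fun x => normr_ge0 _) HC.
have /cvgrPdist_le/(_ _ d0) [Q HQ] := Hs.
exists Q => Z QZ.
have H1 := psum_le_sum (Q `|` Z)%fset (fun x => normr_ge0 (f x)) Hs.
have := HQ Q (fsubset_refl _).
have -> : psum (fun x => `|f x|) Z = psum (fun x => `|f x|) (Q `|` Z)%fset - psum (fun x => `|f x|) Q.
  rewrite (psum_split _ Q (Q `|` Z)%fset) fsetIC fsetKU fsetDUl fsetDv fset0U.
  have -> : (Z `\` Q)%fset = Z by apply/fsetDidPl; rewrite fdisjoint_sym.
  by rewrite addrC addKr.
by move=> /(le_trans (ler_norm _)) H2; lra.
Qed.

Lemma esum_has_sum f s : (forall x, 0 <= f x) -> has_sum f s ->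
  (\esum_(x in [set: V]) (f x)%:E = s%:E)%E.
Proof.
move=> f0 Hf.
have H1 : (\esum_(x in [set: V]) (f x)%:E <= s%:E)%E.
  apply: ge_ereal_sup => _ [A [finA _] <-].
  by rewrite fsbig_finite //= sumEFin lee_fin; exact: psum_le_sum.
have H2 S : ((psum f S)%:E <= \esum_(x in [set: V]) (f x)%:E)%E.
  apply: esum_ge; exists [set` S]; first by split.
  by rewrite fsbig_finite //= sumEFin set_fsetK.
apply/eqP; rewrite eq_le H1 /=.
have : (0 <= \esum_(x in [set: V]) (f x)%:E)%E by apply: esum_ge0 => x _; rewrite lee_fin.
move: H1 H2; case: (\esum_(x in _) _)%E => [r| |] //= _ H2 _.
rewrite lee_fin; apply: has_sum_le Hf _ => S.
by have := H2 S; rewrite lee_fin.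
Qed.

(** [vint] subtracts two extended sums; absolute boundedness makes both finite, so that the
    difference is the unconditional sum. *)
Lemma vint_has_sum (G : wgraph R V) f s : abs_bounded (fun x => f x * meas G x) ->
  has_sum (fun x => f x * meas G x) s -> vint G f = s%:E.
Proof.
move=> Hb Hs.
have [s1 Hs1] := abs_bounded_pos Hb; have [s2 Hs2] := abs_bounded_neg Hb.
have m0 x := ltW (meas_gt0 G x).
have E1 : (fun x => f^\+ x * meas G x) = (fun x => f x * meas G x)^\+.
  by apply/funext => x; rewrite /funrpos maxr_pMl // mul0r.
have E2 : (fun x => f^\- x * meas G x) = (fun x => f x * meas G x)^\-.
  by apply/funext => x; rewrite /funrneg maxr_pMl // mul0r mulNr.
rewrite /vint (@esum_has_sum _ s1); last by rewrite E1.
  rewrite (@esum_has_sum _ s2); last by rewrite E2.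
    rewrite -EFinB; congr EFin; apply: has_sum_unique Hs.
    have := has_sumB Hs1 Hs2; congr (has_sum _ _).
    exact: funrposBneg.
  by move=> x; rewrite mulr_ge0 // funrneg_ge0.
by move=> x; rewrite mulr_ge0 // funrpos_ge0.
Qed.

Lemma vint_finite (G : wgraph R V) f : (forall x, 0 <= f x) -> (vint G f < +oo)%E ->
  exists2 s, has_sum (fun x => f x * meas G x) s & vint G f = s%:E.
Proof.
move=> f0 fin.
have m0 x := ltW (meas_gt0 G x).
have fm0 x : 0 <= f x * meas G x by rewrite mulr_ge0.
have E1 : vint G f = (\esum_(x in [set: V]) (f x * meas G x)%:E)%E.
  rewrite /vint [X in (_ - X)%E](_ : _ = 0%E).
    rewrite sube0; apply: eq_esum => x _; congr (_ * _)%:E.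
    by rewrite /funrpos max_l.
  apply: esum1 => x _; congr EFin; rewrite /funrneg max_r ?mul0r //.
  by rewrite oppr_le0.
have H2 S : ((psum (fun x => f x * meas G x) S)%:E <= vint G f)%E.
  rewrite E1; apply: esum_ge; exists [set` S]; first by split.
  by rewrite fsbig_finite //= sumEFin set_fsetK.
have [C HC] : exists C, forall S, psum (fun x => f x * meas G x) S <= C.
  move: fin H2; case: (vint G f) => [r| |] // _ H; first by exists r => S; have := H S; rewrite lee_fin.
  by have := H fset0.
have [s Hs] := has_sum_pos_exists fm0 HC.
exists s => //; apply: vint_has_sum => //.
by exists C => S; under eq_fun do rewrite ger0_norm //.
Qed.

(* Vitali's convergence theorem for sums: the tails are uniformly small because
   [t i] has bounded sum and its coefficient is arbitrarily small. *)
Lemma vitali_sum (I : Type) (U : set_system I) (FU : ProperFilter U)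
    (f t : I -> V -> R) (s : I -> R) (f_ : V -> R) (C : R) :
  (forall x, f i x @[i --> U] --> f_ x) ->
  (forall i, has_sum (f i) (s i)) ->
  (forall i S, psum (t i) S <= C) ->
  (forall d, 0 < d -> exists w : V -> R, abs_bounded w /\
     forall i x, `|f i x| <= d * t i x + w x) ->
  abs_bounded f_ /\ exists2 s_, has_sum f_ s_ & s i @[i --> U] --> s_.
Proof.
move=> cvf Hs tC dom.
have C0 : 0 <= C.
  by have [i _] := filter_ex (@filterT _ U _); have := tC i fset0; rewrite /psum big_seq_fset0.
have cvp S : psum (f i) S @[i --> U] --> psum f_ S.
  by apply: cvg_big => //; exact: add_continuous.
have cvpn S : psum (fun x => `|f i x|) S @[i --> U] --> psum (fun x => `|f_ x|) S.
  by apply: cvg_big => //; [exact: add_continuous|move=> x _; exact: cvg_norm].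
have tail d : 0 < d -> exists Q, forall i Z, [disjoint Q & Z]%fset ->
    psum (fun x => `|f i x|) Z <= d.
  (* This coefficient makes the part carried by [t i] at most [d / 2]; the summand 1 covers
     [C = 0]. *)
  move=> d0; have d1 : 0 < d / 2 / (C + 1) by rewrite !divr_gt0 // ltr_wpDl.
  have [w [wb Hw]] := dom _ d1.
  have d2 : 0 < d / 2 by rewrite divr_gt0.
  have [Q HQ] := abs_tail wb d2.
  exists Q => i Z QZ.
  apply: le_trans (psum_le _ (Hw i)) _; rewrite psumD psumZ.
  have H1 : psum w Z <= d / 2 by apply: le_trans (HQ _ QZ); apply: psum_le => x; exact: ler_norm.
  have H2 : d / 2 / (C + 1) * psum (t i) Z <= d / 2.
    apply: (@le_trans _ _ (d / 2 / (C + 1) * (C + 1))).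
      by rewrite ler_pM2l // (le_trans (tC i Z)) // lerDl.
    by rewrite divfK // gt_eqF // ltr_wpDl.
  lra.
have tail_ d : 0 < d -> exists Q, (forall i Z, [disjoint Q & Z]%fset ->
    psum (fun x => `|f i x|) Z <= d) /\ (forall Z, [disjoint Q & Z]%fset ->
    psum (fun x => `|f_ x|) Z <= d).
  move=> /tail[Q HQ]; exists Q; split=> // Z QZ.
  by apply: (cvgr_to_le (cvpn Z)); apply: nearW => i; exact: HQ.
have bf : abs_bounded f_.
  have [Q [_ HQ]] := tail_ 1 ltr01.
  exists (psum (fun x => `|f_ x|) Q + 1) => S.
  rewrite (psum_split _ Q) lerD //.
    by apply: psum_subset => //; exact: fsubsetIr.
  by apply: HQ; apply/fdisjointP => x xQ; rewrite in_fsetD xQ.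
split=> //; have [s_ Hs_] := abs_bounded_has_sum bf.
exists s_ => //; apply/cvgrPdist_le => e e0.
have e3 : 0 < e / 3 by rewrite divr_gt0.
have [Q [HQ HQ_]] := tail_ _ e3.
have near_sum (k : V -> R) r : has_sum k r -> (forall Z, [disjoint Q & Z]%fset ->
    psum (fun x => `|k x|) Z <= e / 3) -> `|r - psum k Q| <= e / 3.
  move=> Hr Hk.
  have : `|psum k S - psum k Q| @[S --> @fin_filter V] --> `|r - psum k Q|.
    by apply: cvg_norm; apply: cvgB => //; exact: cvg_cst.
  move=> /cvgr_to_le; apply; exists Q => S QS.
  rewrite (psum_split _ Q S) (fsetIidPr QS) addrC addKr.
  apply: le_trans (psum_norm _ _) _; apply: Hk.
  by apply/fdisjointP => x xQ; rewrite in_fsetD xQ.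
have /cvgrPdist_le/(_ _ e3) := cvp Q; apply: filterS => i Hi.
have H1 := near_sum _ _ Hs_ HQ_.
have H2 := near_sum _ _ (Hs i) (HQ i).
move: H1 H2 Hi; rewrite !ler_norml => /andP[? ?] /andP[? ?] /andP[? ?].
by apply/andP; split; lra.
Qed.

End Sums.

(** * Calculus on the graph *)

Section Graph.
Variables (R : realType) (V : choiceType) (G : wgraph R V).
Hypothesis Glf : locally_finite G.
Implicit Types (u v : V -> R) (x y : V) (Z : {fset V}).

Definition nb x : {fset V} := fset_set (nbhd G x).

(** Setting the weight to 0 off the edges makes it symmetric on all pairs, and sums over [nb x] can
    be enlarged to any finite set containing [nb x]. *)
Definition wt x y : R := if adj G x y then weight G x y else 0.

(** The square of [gradn]; it avoids the square root, which is not differentiable at 0. [gdot] below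
    is its polarization. *)
Definition gsq u x : R :=
  (2 * meas G x)^-1 * \sum_(y <- nb x) wt x y * (u y - u x) ^+ 2.

Definition gdot u v x : R :=
  (2 * meas G x)^-1 * \sum_(y <- nb x) wt x y * ((u y - u x) * (v y - v x)).

(** A function supported in [Z] has its gradient supported here, so this is where the energy of such
    a function must be summed. *)
Definition closed_nb Z : {fset V} := (Z `|` \bigcup_(x <- Z) nb x)%fset.

Lemma mem_nb x y : (y \in nb x) = adj G x y.
Proof.
rewrite in_fset_set; last exact: Glf.
by apply/idP/idP => [/set_mem|H]; last exact: mem_set.
Qed.

Lemma wt_sym x y : wt x y = wt y x.
Proof.
by rewrite /wt adj_sym; case: ifP => // H; rewrite weight_sym // adj_sym.
Qed.

Lemma wt_ge0 x y : 0 <= wt x y.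
Proof. by rewrite /wt; case: ifP => // /weight_gt0/ltW. Qed.

Lemma wt_nb0 x y : y \notin nb x -> wt x y = 0.
Proof. by rewrite mem_nb /wt => /negbTE ->. Qed.

Lemma wt_nb x y : y \in nb x -> wt x y = weight G x y.
Proof. by rewrite mem_nb /wt => ->. Qed.

Lemma sum_nbhd (f : V -> R) x : \sum_(y \in nbhd G x) f y = \sum_(y <- nb x) f y.
Proof. by rewrite fsbig_finite //; exact: Glf. Qed.

Lemma sub_closed_nb Z : (Z `<=` closed_nb Z)%fset.
Proof. exact: fsubsetUl. Qed.

Lemma nb_closed_nb Z x : x \in Z -> (nb x `<=` closed_nb Z)%fset.
Proof.
move=> xZ; apply/fsubsetP => y yx; rewrite in_fsetU; apply/orP; right.
by apply/bigfcupP; exists x => //; rewrite xZ.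
Qed.

Lemma closed_nbP Z x y : x \notin closed_nb Z -> y \in nb x -> y \notin Z.
Proof.
move=> xZ yx; apply/negP => yZ; move/negP: xZ; apply.
by apply: (fsubsetP (nb_closed_nb yZ)); move: yx; rewrite !mem_nb adj_sym.
Qed.

Lemma meas2_gt0 x : 0 < (2 * meas G x)^-1.
Proof. by rewrite invr_gt0 mulr_gt0 // meas_gt0. Qed.

Lemma gsq_ge0 u x : 0 <= gsq u x.
Proof.
rewrite mulr_ge0 ?(ltW (meas2_gt0 x)) //.
by apply: sumr_ge0 => y _; rewrite mulr_ge0 ?wt_ge0 ?sqr_ge0.
Qed.

Lemma gdotxx u x : gdot u u x = gsq u x.
Proof. by []. Qed.

Lemma gradn_powR u x (s : R) : gradn G u x `^ s = gsq u x `^ (s / 2).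
Proof.
rewrite /gradn sum_nbhd.
have -> : \sum_(y <- nb x) weight G x y * (u y - u x) ^+ 2 =
    \sum_(y <- nb x) wt x y * (u y - u x) ^+ 2.
  by rewrite big_seq [RHS]big_seq; apply: eq_bigr => y yx; rewrite wt_nb.
rewrite -/(gsq u x) -powR12_sqrt ?gsq_ge0 // -powRrM; congr (_ `^ _).
by rewrite mulrC.
Qed.

Lemma plaplacianE p u x : plaplacian G p u x = (2 * meas G x)^-1 *
  \sum_(y <- nb x) (gsq u y `^ (p / 2 - 1) + gsq u x `^ (p / 2 - 1)) *
    wt x y * (u y - u x).
Proof.
rewrite /plaplacian sum_nbhd; congr (_ * _).
rewrite big_seq [RHS]big_seq; apply: eq_bigr => y yx.
by rewrite wt_nb // !gradn_powR (_ : (p - 2) / 2 = p / 2 - 1) // mulrBl mulfV.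
Qed.

Lemma gsq_near0 Z u x : (forall y, y \notin Z -> u y = 0) ->
  x \notin closed_nb Z -> gsq u x = 0.
Proof.
move=> u0 xZ; rewrite /gsq big_seq big1 ?mulr0 // => y yx.
rewrite (u0 _ (closed_nbP xZ yx)) (u0 x) ?subrr ?expr0n ?mulr0 //.
by apply: contra xZ; exact/fsubsetP/sub_closed_nb.
Qed.

Lemma gsqB_le u v x : gsq (fun y => u y - v y) x <= 2 * gsq u x + 2 * gsq v x.
Proof.
have k0 := ltW (meas2_gt0 x); rewrite /gsq; move: (_^-1) k0 => k k0.
rewrite !(mulrCA 2 k) -mulrDr ler_wpM2l //.
rewrite !mulr_sumr -big_split /=; apply: ler_sum => y _.
rewrite !(mulrCA 2) -mulrDr ler_wpM2l ?wt_ge0 //.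
have := sqr_ge0 ((u y - u x) + (v y - v x)); nra.
Qed.

Lemma gsqZ c u x : gsq (fun y => c * u y) x = c ^+ 2 * gsq u x.
Proof.
rewrite /gsq mulrCA; congr (_ * _); rewrite mulr_sumr; apply: eq_bigr => y _.
by rewrite -mulrBr exprMn mulrCA.
Qed.

(** The inequality between arithmetic and geometric means on each edge. The free parameter [d] will
    make the coefficient of [v] as small as Vitali's theorem requires. *)
Lemma gdot_le d u v x : 0 < d ->
  `|gdot u v x| <= d^-1 / 2 * gsq u x + d / 2 * gsq v x.
Proof.
move=> d0; rewrite /gdot normrM (gtr0_norm (meas2_gt0 x)) /gsq.
have k0 := meas2_gt0 x; move: (2 * meas G x)^-1 k0 => k k0.
rewrite !(mulrCA _ k) -mulrDr ler_pM2l //.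
rewrite (le_trans (ler_norm_sum _ _ _)) // !mulr_sumr -big_split /=.
apply: ler_sum => y _; rewrite normrM (ger0_norm (wt_ge0 x y)).
rewrite !(mulrCA (_ / 2)) -mulrDr ler_wpM2l ?wt_ge0 //.
set a := u y - u x; set b := v y - v x.
have di : d^-1 * d = 1 by rewrite mulVf ?gt_eqF.
have dp : 0 < d^-1 by rewrite invr_gt0.
have H1 := sqr_ge0 (a + d * b); have H2 := sqr_ge0 (a - d * b).
have -> : a * (d^-1 / 2 * a) + b * (d / 2 * b) = d^-1 / 2 * (a ^+ 2 + d ^+ 2 * b ^+ 2).
  by field; rewrite gt_eqF.
have -> : `|a * b| = d^-1 / 2 * (2 * `|d * (a * b)|).
  by rewrite (normrM d) (gtr0_norm d0); field; rewrite gt_eqF.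
rewrite ler_pM2l ?divr_gt0 //.
have [ab|ab] := leP 0 (d * (a * b)); [rewrite ger0_norm //|rewrite ltr0_norm //]; nra.
Qed.

Section Limits.
Variables (I : Type) (U : set_system I) (FU : ProperFilter U).
Variables (u v : I -> V -> R) (u_ v_ : V -> R).
Hypothesis cvu : forall x, u i x @[i --> U] --> u_ x.
Hypothesis cvv : forall x, v i x @[i --> U] --> v_ x.

Lemma cvg_gdot x : gdot (u i) (v i) x @[i --> U] --> gdot u_ v_ x.
Proof.
apply: cvgM; first exact: cvg_cst.
apply: cvg_big => //; first exact: add_continuous.
move=> y _; apply: cvgM; first exact: cvg_cst.
by apply: cvgM; apply: cvgB.
Qed.

Lemma cvg_gsq x : gsq (u i) x @[i --> U] --> gsq u_ x.
Proof.
apply: cvgM; first exact: cvg_cst.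
apply: cvg_big => //; first exact: add_continuous.
move=> y _; apply: cvgM; first exact: cvg_cst.
by rewrite /GRing.exp /=; apply: cvgM; apply: cvgB.
Qed.

Lemma cvg_gsq_powR (s : R) x : 0 <= s -> gsq (u i) x `^ s @[i --> U] --> gsq u_ x `^ s.
Proof.
by move=> s0; apply: cvg_powR => //; [exact: cvg_gsq|move=> i; exact: gsq_ge0].
Qed.

Lemma cvg_plaplacian p x : 2 <= p ->
  plaplacian G p (u i) x @[i --> U] --> plaplacian G p u_ x.
Proof.
move=> p2; have p0 : 0 <= p / 2 - 1 by lra.
rewrite plaplacianE; under eq_fun do rewrite plaplacianE.
apply: cvgM; first exact: cvg_cst.
apply: cvg_big => //; first exact: add_continuous.
move=> y _; apply: cvgM; last exact: cvgB.
apply: cvgM; last exact: cvg_cst.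
by apply: cvgD; exact: cvg_gsq_powR.
Qed.

End Limits.

(* Summation by parts: exchange the two ends of each edge. *)
Lemma green p u v Z : (forall x, x \notin Z -> v x = 0) ->
  psum (fun x => gsq u x `^ (p / 2 - 1) * gdot u v x * meas G x) (closed_nb Z) =
  - psum (fun x => plaplacian G p u x * v x * meas G x) Z.
Proof.
move=> v0; set Y := closed_nb Z.
pose m x := gsq u x `^ (p / 2 - 1).
have nbY x (f : V -> R) : x \in Z ->
    \sum_(y <- nb x) wt x y * f y = \sum_(y <- Y) wt x y * f y.
  move=> xZ; rewrite (big_fset_incl _ (nb_closed_nb xZ)) // => y _ yx.
  by rewrite wt_nb0 ?mul0r.
have E1 : psum (fun x => m x * gdot u v x * meas G x) Y =
    2^-1 * \sum_(x <- Y) \sum_(y <- Y)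
      m x * (wt x y * ((u y - u x) * (v y - v x))).
  rewrite /psum mulr_sumr big_seq [RHS]big_seq; apply: eq_bigr => x xY.
  have -> : \sum_(y <- Y) m x * (wt x y * ((u y - u x) * (v y - v x))) =
      m x * \sum_(y <- nb x) wt x y * ((u y - u x) * (v y - v x)).
    rewrite mulr_sumr; have [xZ|xZ] := boolP (x \in Z).
      by rewrite -mulr_sumr -nbY // mulr_sumr.
    (* For [x] outside [Z], [nb x] need not lie in [Y]; a neighbour outside [Y] contributes 0
       because [v] vanishes at both ends of the edge. *)
    rewrite (bigID (fun y => y \in nb x)) /= [X in _ + X]big1 ?addr0; last first.
      by move=> y /wt_nb0 ->; rewrite mul0r mulr0.
    have vx : v x = 0 by exact: v0.
    rewrite [RHS](bigID (fun y => y \in Y)) /= [X in _ = _ + X]big1_seq ?addr0; last first.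
      move=> y /andP[yY yx]; rewrite vx v0 ?subrr ?mulr0 //.
      by apply: contra yY; exact/fsubsetP/sub_closed_nb.
    rewrite -[LHS]big_filter -[RHS]big_filter; apply: perm_big.
    apply: uniq_perm; rewrite ?filter_uniq ?fset_uniq //.
    by move=> y; rewrite !mem_filter andbC.
  have mx : meas G x != 0 by rewrite gt_eqF // meas_gt0.
  by rewrite /gdot; field; rewrite mx.
have E2 : psum (fun x => plaplacian G p u x * v x * meas G x) Z =
    2^-1 * \sum_(x <- Y) \sum_(y <- Y)
      (m y + m x) * (wt x y * ((u y - u x) * v x)).
  rewrite -(psum_extend (sub_closed_nb Z)); last by move=> x /v0 ->; rewrite mulr0 mul0r.
  rewrite /psum mulr_sumr big_seq [RHS]big_seq; apply: eq_bigr => x xY.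
  have [xZ|xZ] := boolP (x \in Z); last first.
    rewrite v0 // mulr0 mul0r big1 ?mulr0 // => y _; by rewrite !mulr0.
  have -> : \sum_(y <- Y) (m y + m x) * (wt x y * ((u y - u x) * v x)) =
      (\sum_(y <- nb x) (m y + m x) * wt x y * (u y - u x)) * v x.
    have H1 : \sum_(y <- nb x) (m y + m x) * wt x y * (u y - u x) =
        \sum_(y <- nb x) wt x y * ((m y + m x) * (u y - u x)).
      by apply: eq_bigr => y _; rewrite mulrAC mulrC.
    rewrite H1 nbY // mulr_suml; apply: eq_bigr => y _; ring.
  have mx : meas G x != 0 by rewrite gt_eqF // meas_gt0.
  by rewrite plaplacianE -/(m x); field; rewrite mx.
rewrite E1 E2 -mulrN; congr (_ * _).
have -> : \sum_(x <- Y) \sum_(y <- Y) m x * (wt x y * ((u y - u x) * (v y - v x))) =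
  \sum_(x <- Y) \sum_(y <- Y) m x * (wt x y * ((u y - u x) * v y)) -
  \sum_(x <- Y) \sum_(y <- Y) m x * (wt x y * ((u y - u x) * v x)).
  by rewrite -sumrB; apply: eq_bigr => x _; rewrite -sumrB; apply: eq_bigr => y _; ring.
have -> : \sum_(x <- Y) \sum_(y <- Y) (m y + m x) * (wt x y * ((u y - u x) * v x)) =
  \sum_(x <- Y) \sum_(y <- Y) m y * (wt x y * ((u y - u x) * v x)) +
  \sum_(x <- Y) \sum_(y <- Y) m x * (wt x y * ((u y - u x) * v x)).
  by rewrite -big_split; apply: eq_bigr => x _; rewrite -big_split; apply: eq_bigr => y _ /=; ring.
rewrite opprD; congr (_ + _).
rewrite exchange_big /= -sumrN; apply: eq_bigr => x _.
by rewrite -sumrN; apply: eq_bigr => y _; rewrite wt_sym; ring.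
Qed.

Lemma is_derive_gsq u v x (t : R) :
  is_derive t 1 (fun s => gsq (fun y => u y + s * v y) x)
    (2 * gdot (fun y => u y + t * v y) v x).
Proof.
pose a : R := gsq v x; pose b : R := gdot u v x; pose c : R := gsq u x.
have E s : gsq (fun y => u y + s * v y) x = a * s ^+ 2 + (2 * b) * s + c.
  rewrite /a /b /c /gsq /gdot; move: (_^-1) => k.
  rewrite mulrAC (mulrCA 2 k) [k * _ * s]mulrAC -!mulrA.
  rewrite -!mulrDr; congr (_ * _); rewrite !mulr_sumr -!big_split /= mulr_sumr -big_split /=.
  by apply: eq_bigr => y _; ring.
have E' : gdot (fun y => u y + t * v y) v x = a * t + b.
  rewrite /a /b /gsq /gdot -!mulrA -!mulrDr; congr (_ * _).
  rewrite !mulr_suml -!big_split /=.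
  by apply: eq_bigr => y _; ring.
under eq_fun do rewrite E.
rewrite E'.
apply: is_derive_eq.
by rewrite /GRing.scale /=; ring.
Qed.

End Graph.

Lemma is_derive_big (R : realType) (T : Type) (l : seq T) (f : T -> R -> R)
    (df : T -> R) (t : R) :
  (forall x, is_derive t 1 (f x) (df x)) ->
  is_derive t 1 (fun s => \sum_(x <- l) f x s) (\sum_(x <- l) df x).
Proof.
move=> H; elim: l => [|x l IH].
  rewrite big_nil (_ : (fun s => _) = cst 0); first exact: is_derive_cst.
  by apply/funext => s; rewrite big_nil.
rewrite big_cons (_ : (fun s => _) = f x + (fun s => \sum_(x <- l) f x s)).
  exact: is_deriveD.
by apply/funext => s; rewrite big_cons.
Qed.

(** * The density of the norm, its derivative, and their limits *)

Section Densities.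
Variables (R : realType) (V : choiceType) (G : wgraph R V).
Hypothesis Glf : locally_finite G.
Variables (mu0 p h0 : R) (h : V -> R).
Hypothesis mu0_gt0 : 0 < mu0.
Hypothesis meas_ge : forall x, mu0 <= meas G x.
Hypothesis p_ge2 : 2 <= p.
Hypothesis h0_gt0 : 0 < h0.
Hypothesis h_ge : forall x, h0 <= h x.
Implicit Types (u v : V -> R) (x y : V) (Z : {fset V}).

Definition dens u x : R := gsq G u x `^ (p / 2) + h x * (u x ^+ 2) `^ (p / 2).

(** The derivative of [dens / p] at [u] in the direction [v], linear in [v] only; this is the
    integrand of the weak form of the operator. *)
Definition bil u v x : R := gsq G u x `^ (p / 2 - 1) * gdot G u v x +
  h x * ((u x ^+ 2) `^ (p / 2 - 1) * (u x * v x)).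

Definition tdens u x : R := dens u x * meas G x.

Let r_ge1 : 1 <= p / 2. Proof. by rewrite ler_pdivlMr // mul1r. Qed.
Let r_gt0 : 0 < p / 2. Proof. exact: lt_le_trans ltr01 r_ge1. Qed.
Let r1_ge0 : 0 <= p / 2 - 1. Proof. by rewrite subr_ge0. Qed.
Let p_gt0 : 0 < p. Proof. exact: lt_le_trans p_ge2. Qed.
Let h_gt0 x : 0 < h x. Proof. exact: lt_le_trans (h_ge x). Qed.
Let m_gt0 x : 0 < meas G x. Proof. exact: meas_gt0. Qed.
Let g_ge0 u x : 0 <= gsq G u x. Proof. exact: gsq_ge0. Qed.

Lemma dens_ge0 u x : 0 <= dens u x.
Proof. by rewrite addr_ge0 ?powR_ge0 // mulr_ge0 ?powR_ge0 // ltW. Qed.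

Lemma tdens_ge0 u x : 0 <= tdens u x.
Proof. by rewrite mulr_ge0 ?dens_ge0 // ltW. Qed.

Lemma densE u x : dens u x = gradn G u x `^ p + h x * `|u x| `^ p.
Proof. by rewrite gradn_powR // normX2_powR. Qed.

Lemma dens_ge_hu u x : h x * `|u x| `^ p <= dens u x.
Proof. by rewrite densE lerDr powR_ge0. Qed.

Lemma dens_ge_u u x : h0 * `|u x| `^ p <= dens u x.
Proof. by apply: le_trans (dens_ge_hu u x); rewrite ler_wpM2r ?powR_ge0. Qed.

Lemma tdens_ge_u u x : h0 * mu0 * `|u x| `^ p <= tdens u x.
Proof.
rewrite /tdens mulrAC; apply: ler_pM; rewrite ?mulr_ge0 ?powR_ge0 ?(ltW h0_gt0) ?(ltW mu0_gt0) //.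
exact: dens_ge_u.
Qed.

Lemma tdens_supp Z u x : (forall y, y \notin Z -> u y = 0) ->
  x \notin closed_nb G Z -> tdens u x = 0.
Proof.
move=> u0 xZ; rewrite /tdens /dens (gsq_near0 Glf u0 xZ) u0.
  by rewrite expr0n /= powR0 ?gt_eqF // mulr0 addr0 mul0r.
by apply: contra xZ; exact/fsubsetP/sub_closed_nb.
Qed.

Lemma bilxx u x : bil u u x = dens u x.
Proof.
rewrite /bil /dens gdotxx -expr2; congr (_ + h x * _).
  by rewrite mulrC mulr_powRB1.
by rewrite mulrC mulr_powRB1 // sqr_ge0.
Qed.

(** The asymmetry is intended: [u] will be the fixed limit, whose density is summable, and [v] an
    approximation, whose density has only a bounded sum and must get a small coefficient. *)
Lemma bil_le d u v x : 0 < d ->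
  `|bil u v x| <= d * dens v x + (d^-1 + d) * dens u x.
Proof.
move=> d0; have di0 : 0 < d^-1 by rewrite invr_gt0.
have key (a b c : R) : 0 <= a -> 0 <= b -> `|c| <= d^-1 / 2 * a + d / 2 * b ->
    `|a `^ (p / 2 - 1) * c| <= d * b `^ (p / 2) + (d^-1 + d) * a `^ (p / 2).
  move=> a0 b0 cab; rewrite normrM (ger0_norm (powR_ge0 _ _)).
  apply: le_trans (ler_wpM2l (powR_ge0 _ _) cab) _.
  have H := powR_mul_le a0 b0 r_ge1.
  have E : a `^ (p / 2 - 1) * a = a `^ (p / 2) by rewrite mulrC mulr_powRB1.
  have := powR_ge0 a (p / 2); have := powR_ge0 b (p / 2).
  move: H E; set P := _ `^ (_ - 1); set Q := a `^ _; set S := b `^ _ => H E S0 Q0.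
  have -> : P * (d^-1 / 2 * a + d / 2 * b) = d^-1 / 2 * (P * a) + d / 2 * (P * b) by ring.
  rewrite E; have := ler_wpM2l (ltW d0) H.
  have := mulr_ge0 (ltW d0) S0; have := mulr_ge0 (ltW di0) Q0.
  have := mulr_ge0 (ltW d0) Q0; nra.
have H1 := key _ _ _ (g_ge0 u x) (g_ge0 v x) (gdot_le G u v x d0).
have H2 : `|u x * v x| <= d^-1 / 2 * (u x ^+ 2) + d / 2 * (v x ^+ 2).
  have E : d^-1 / 2 * (u x ^+ 2) + d / 2 * (v x ^+ 2) - `|u x * v x| =
      d^-1 / 2 * (`|u x| - d * `|v x|) ^+ 2.
    rewrite normrM -(real_normK (num_real (u x))) -(real_normK (num_real (v x))).
    by field; rewrite gt_eqF.
  by rewrite -subr_ge0 E mulr_ge0 ?sqr_ge0 // divr_ge0 // ltW.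
have H3 := ler_wpM2l (ltW (h_gt0 x)) (key _ _ _ (sqr_ge0 _) (sqr_ge0 _) H2).
rewrite /bil /dens (le_trans (ler_normD _ _)) // (normrM (h x)) (gtr0_norm (h_gt0 x)).
move: H1 H3; lra.
Qed.

Lemma densB_le u v x : dens (fun y => u y - v y) x <=
  2 `^ (p / 2) * 2 `^ (p / 2) * (dens u x + dens v x).
Proof.
have key (a b c : R) : 0 <= a -> 0 <= b -> 0 <= c -> c <= 2 * a + 2 * b ->
    c `^ (p / 2) <= 2 `^ (p / 2) * 2 `^ (p / 2) * (a `^ (p / 2) + b `^ (p / 2)).
  move=> a0 b0 c0; rewrite -mulrDr => cab.
  have ab0 : 0 <= a + b by rewrite addr_ge0.
  apply: (@le_trans _ _ ((2 * (a + b)) `^ (p / 2))).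
    by rewrite ge0_ler_powR ?nnegrE ?mulr_ge0 // ltW.
  by rewrite powRM // -mulrA ler_wpM2l ?powR_ge0 // powRD_le // ltW.
have H1 := key _ _ _ (g_ge0 u x) (g_ge0 v x) (g_ge0 _ x) (gsqB_le G u v x).
have H2 : (u x - v x) ^+ 2 <= 2 * u x ^+ 2 + 2 * v x ^+ 2.
  by have := sqr_ge0 (u x + v x); nra.
have H3 := ler_wpM2l (ltW (h_gt0 x)) (key _ _ _ (sqr_ge0 _) (sqr_ge0 _) (sqr_ge0 _) H2).
rewrite /dens; move: H1 H3; set K := _ * _; lra.
Qed.

Lemma densZ c u x : dens (fun y => c * u y) x = `|c| `^ p * dens u x.
Proof.
have H b : 0 <= b -> (c ^+ 2 * b) `^ (p / 2) = `|c| `^ p * b `^ (p / 2).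
  by move=> b0; rewrite powRM ?sqr_ge0 // normX2_powR.
by rewrite /dens gsqZ exprMn !H ?sqr_ge0 //; ring.
Qed.

Lemma is_derive_dens u v x (t : R) :
  is_derive t 1 (fun s => p^-1 * dens (fun y => u y + s * v y) x)
    (bil (fun y => u y + t * v y) v x).
Proof.
pose w := fun y => u y + t * v y.
have D1 := @is_derive_powR_ge0 R _ t _ (p / 2) (fun s => g_ge0 (fun y => u y + s * v y) x)
  (is_derive_gsq G u v x t) r_ge1.
have Dq : is_derive t 1 (fun s => (u x + s * v x) ^+ 2) (2 * (w x * v x)).
  rewrite (_ : (fun s => _) = (fun s => v x ^+ 2 * s ^+ 2 + (2 * u x * v x) * s + u x ^+ 2)).
    by apply: is_derive_eq; rewrite /GRing.scale /= /w; ring.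
  by apply/funext => s; ring.
have D2 := @is_derive_powR_ge0 R _ t _ (p / 2) (fun s => sqr_ge0 (u x + s * v x)) Dq r_ge1.
have D3 := is_deriveD (is_deriveZ p^-1 D1) (is_deriveZ (p^-1 * h x) D2).
move: D3; congr (is_derive _ _ _ _).
  by apply/funext => s; rewrite /dens /= mulrDr mulrA.
by rewrite /bil /GRing.scale /= -/(w x) -/w; field; rewrite gt_eqF.
Qed.

Section Limits.
Variables (I : Type) (U : set_system I) (FU : ProperFilter U).
Variables (u v : I -> V -> R) (u_ v_ : V -> R).
Hypothesis cvu : forall x, u i x @[i --> U] --> u_ x.
Hypothesis cvv : forall x, v i x @[i --> U] --> v_ x.

Lemma cvg_sqr_powR (s : R) x : 0 <= s ->
  (u i x ^+ 2) `^ s @[i --> U] --> (u_ x ^+ 2) `^ s.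
Proof.
move=> s0; apply: cvg_powR => //; last by move=> i; exact: sqr_ge0.
by rewrite expr2; under eq_fun do rewrite expr2; exact: cvgM.
Qed.

Lemma cvg_dens x : dens (u i) x @[i --> U] --> dens u_ x.
Proof.
apply: cvgD; first by apply: cvg_gsq_powR => //; exact: ltW.
by apply: cvgM; [exact: cvg_cst|apply: cvg_sqr_powR; exact: ltW].
Qed.

Lemma cvg_tdens x : tdens (u i) x @[i --> U] --> tdens u_ x.
Proof. by apply: cvgM; [exact: cvg_dens|exact: cvg_cst]. Qed.

Lemma cvg_bil x : bil (u i) (v i) x @[i --> U] --> bil u_ v_ x.
Proof.
apply: cvgD; apply: cvgM.
- exact: cvg_gsq_powR.
- exact: cvg_gdot.
- exact: cvg_cst.
- by apply: cvgM; [exact: cvg_sqr_powR|exact: cvgM].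
Qed.

End Limits.

Lemma psum_bil u v Z : (forall x, x \notin Z -> v x = 0) ->
  psum (fun x => bil u v x * meas G x) (closed_nb G Z) =
  psum (fun x => (- plaplacian G p u x + h x * `|u x| `^ (p - 2) * u x)
    * v x * meas G x) Z.
Proof.
move=> v0.
rewrite (_ : (fun x => bil u v x * meas G x) = (fun x =>
  gsq G u x `^ (p / 2 - 1) * gdot G u v x * meas G x +
  h x * ((u x ^+ 2) `^ (p / 2 - 1) * (u x * v x)) * meas G x)); last first.
  by apply/funext => x; rewrite mulrDl.
rewrite psumD green // [X in _ + X](psum_extend (sub_closed_nb G Z)); last first.
  by move=> x /v0 ->; rewrite !mulr0 mul0r.
rewrite -psumN -psumD; apply: eq_bigr => x _.
rewrite normX2_powR (_ : (p - 2) / 2 = p / 2 - 1); first by ring.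
by rewrite mulrBl divff.
Qed.

End Densities.

(** * The variational problem *)

(** Normalize both factors and apply Young's inequality pointwise. Taking positive bounds [E] and
    [X] instead of the exact norms avoids division by 0 when [u] vanishes on [S]. *)
Lemma hoelder_psum (R : realType) (V : choiceType) (e u m : V -> R) (p E X : R)
    (S : {fset V}) :
  1 < p -> 0 < E -> 0 < X -> (forall x, 0 <= m x) ->
  psum (fun x => `|e x| `^ (p / (p - 1)) * m x) S <= E ->
  psum (fun x => `|u x| `^ p * m x) S <= X ->
  psum (fun x => `|e x * u x| * m x) S <= E `^ (p / (p - 1))^-1 * X `^ p^-1.
Proof.
move=> p1 E0 X0 m0 HE HX; set q := p / (p - 1).
have p0 : 0 < p by apply: lt_trans p1.
have pm : 0 < p - 1 by rewrite subr_gt0.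
have q0 : 0 < q by rewrite divr_gt0.
have pq : q^-1 + p^-1 = 1 by rewrite /q; field; rewrite !gt_eqF.
set al := E `^ _; set be := X `^ _.
have al0 : 0 < al by rewrite powR_gt0.
have be0 : 0 < be by rewrite powR_gt0.
have alq : al `^ q = E by rewrite -powRrM mulVf ?gt_eqF // powRr1 // ltW.
have bep : be `^ p = X by rewrite -powRrM mulVf ?gt_eqF // powRr1 // ltW.
have iq : al^-1 `^ q = E^-1.
  by rewrite -(powR_inv1 (ltW al0)) -powRrM mulN1r powRN alq.
have ip : be^-1 `^ p = X^-1.
  by rewrite -(powR_inv1 (ltW be0)) -powRrM mulN1r powRN bep.
have pt x : `|e x * u x| * m x <= al * be *
    (q^-1 * (E^-1 * (`|e x| `^ q * m x)) + p^-1 * (X^-1 * (`|u x| `^ p * m x))).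
  have H := @conjugate_powR R (`|e x| / al) (`|u x| / be) q p
    (divr_ge0 (normr_ge0 _) (ltW al0)) (divr_ge0 (normr_ge0 _) (ltW be0)) q0 p0 pq.
  rewrite !powRM ?invr_ge0 ?(ltW al0) ?(ltW be0) // in H.
  rewrite iq ip in H.
  have := ler_wpM2r (m0 x) (ler_wpM2l (ltW (mulr_gt0 al0 be0)) H).
  rewrite normrM; congr (_ <= _).
    by field; rewrite !gt_eqF.
  by field; rewrite !gt_eqF.
apply: le_trans (psum_le S pt) _.
rewrite psumZ -[leRHS]mulr1 ler_pM2l ?mulr_gt0 // psumD !psumZ -[leRHS]pq.
apply: lerD.
  by rewrite ler_piMr ?invr_ge0 ?(ltW q0) // ler_pdivrMl // mulr1.
by rewrite ler_piMr ?invr_ge0 ?(ltW p0) // ler_pdivrMl // mulr1.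
Qed.

Section Problem.
Variables (R : realType) (V : choiceType) (G : wgraph R V).
Hypothesis Glf : locally_finite G.
Variables (mu0 p h0 : R) (h : V -> R) (F : V -> R -> R) (e : V -> R).
Hypothesis mu0_gt0 : 0 < mu0.
Hypothesis meas_ge : forall x, mu0 <= meas G x.
Hypothesis p_ge2 : 2 <= p.
Hypothesis h0_gt0 : 0 < h0.
Hypothesis h_ge : forall x, h0 <= h x.
Hypothesis F_C1 : forall x, (forall s, derivable (F x) s 1) /\ continuous (dF F x).
Variables (a : R -> R) (b : V -> R).
Hypothesis a_cont : {within `[0, +oo[, continuous a}.
Hypothesis b_ge0 : forall x, 0 <= b x.
Hypothesis b_sum : abs_bounded (fun x => b x * meas G x).
Hypothesis dF_bound : forall x s, `|dF F x s| <= a `|s| * b x.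
Hypothesis F_bound : forall x s, `|F x s| <= a `|s| * b x.
Hypothesis F0 : forall x, F x 0 = 0.
Variable l0 : R.
Hypothesis l0_gt0 : 0 < l0.
Hypothesis c1 : forall x s, `|s| < l0 ->
  `|dF F x s| <= h0 / (p + 1) * `|s| `^ (p - 1).
Variables nu A : R.
Hypothesis nu_gt : p < nu.
Hypothesis A_ge0 : 0 <= A.
Hypothesis A_lt : A < h0 * (nu / p - 1).
Hypothesis c3 : forall x s, nu * F x s - dF F x s * s <= A * `|s| `^ p.
Variables eps E : R.
Hypothesis eps_gt0 : 0 < eps.
Hypothesis e_sum : has_sum (fun x => `|e x| `^ (p / (p - 1)) * meas G x) E.

Implicit Types (u v : V -> R) (x y : V) (Z S : {fset V}).
Local Notation q := (p / (p - 1)).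
Local Notation dens := (dens G p h).
Local Notation tdens := (tdens G p h).
Local Notation bil := (bil G p h).
Local Notation closed_nb := (closed_nb G).
Local Notation m := (meas G).

Let p_gt0 : 0 < p. Proof. exact: lt_le_trans p_ge2. Qed.
Let p_gt1 : 1 < p. Proof. by apply: lt_le_trans p_ge2; rewrite ltr1n. Qed.
Let m_gt0 x : 0 < m x. Proof. exact: meas_gt0. Qed.
Let tdens0 u x : 0 <= tdens u x. Proof. exact: (tdens_ge0 _ _ h0_gt0 h_ge). Qed.

(** The residual of the equation. Multiplied by the measure, it is the partial derivative of the
    energy with respect to the value at [x]. *)
Definition res u x : R := - plaplacian G p u x + h x * `|u x| `^ (p - 2) * u x
  - dF F x (u x) - eps * e x.

Definition edens u x : R :=
  (p^-1 * dens u x - F x (u x) - eps * (e x * u x)) * m x.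

Lemma is_derive_F x (s : R) : is_derive s 1 (F x) (dF F x s).
Proof. by split; [have [] := F_C1 x|rewrite /dF derive1E]. Qed.

Lemma F_continuous x : continuous (F x).
Proof.
move=> s; apply: differentiable_continuous; apply/derivable1_diffP.
by have [] := F_C1 x.
Qed.

Lemma a_bounded K : exists2 M, 0 <= M & forall t, 0 <= t -> t <= K -> a t <= M.
Proof.
have cw : {within `[0, Num.max 0 K], continuous a}.
  apply: continuous_subspaceW a_cont => t /=.
  by rewrite !in_itv /= => /andP[-> _].
have [|c _ Hc] := @EVT_max R a 0 (Num.max 0 K) _ cw; first by rewrite le_max lexx.
exists (Num.max 0 (a c)); first by rewrite le_max lexx.
move=> t t0 tK; rewrite le_max; apply/orP; right; apply: Hc.
by rewrite in_itv /= t0 le_max tK orbT.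
Qed.

Lemma F_bounded K : exists2 M, 0 <= M & forall x s, `|s| <= K ->
  `|F x s| <= M * b x /\ `|dF F x s| <= M * b x.
Proof.
have [M M0 HM] := a_bounded K; exists M => // x s sK.
have H : a `|s| * b x <= M * b x by rewrite ler_wpM2r // HM.
by split; [apply: le_trans (F_bound x s) H|apply: le_trans (dF_bound x s) H].
Qed.

Lemma psum_res u v Z : (forall x, x \notin Z -> v x = 0) ->
  psum (fun x => res u x * v x * m x) Z =
  psum (fun x => bil u v x * m x) (closed_nb Z)
  - psum (fun x => dF F x (u x) * v x * m x) Z
  - eps * psum (fun x => e x * v x * m x) Z.
Proof.
move=> v0; rewrite psum_bil // -psumZ -!psumN -!psumD; apply: eq_bigr => x _.
by rewrite /res; ring.
Qed.

(** A variation supported in [Z] changes the energy density only on [closed_nb Z], and [psum_res]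
    brings the derivative back to a sum over [Z]. *)
Lemma is_derive_energy u v Z (t : R) : (forall x, x \notin Z -> v x = 0) ->
  is_derive t 1 (fun s => psum (edens (fun y => u y + s * v y)) (closed_nb Z))
    (psum (fun x => res (fun y => u y + t * v y) x * v x * m x) Z).
Proof.
move=> v0; set w := fun y => u y + t * v y.
have D x : is_derive t 1 (fun s => edens (fun y => u y + s * v y) x)
    ((bil w v x - dF F x (w x) * v x - eps * (e x * v x)) * m x).
  have Da : is_derive t 1 (fun s : R => u x + s * v x) (v x).
    by apply: is_derive_eq; rewrite /GRing.scale /=; ring.
  have D1 := is_derive_dens G h p_ge2 u v x t.
  have D2 := @is_derive1_comp R (F x) (fun s : R => u x + s * v x) t _ _
    (is_derive_F x (w x)) Da.
  have D3 := is_deriveZ (m x) (is_deriveB (is_deriveB D1 D2) (is_deriveZ (eps * e x) Da)).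
  move: D3; congr (is_derive _ _ _ _).
    apply/funext => s; transitivity (m x * (p^-1 * dens (fun y => u y + s * v y) x
      - F x (u x + s * v x) - eps * e x * (u x + s * v x))) => //.
    by rewrite /edens; ring.
  by rewrite /GRing.scale /= -/w; ring.
have := is_derive_big (enum_fset (closed_nb Z)) D.
congr (is_derive _ _ _ _).
rewrite psum_res // -(psum_extend (sub_closed_nb G Z) (f := fun x => dF F x (w x) * v x * m x)); last first.
  by move=> x /v0 ->; rewrite mulr0 mul0r.
rewrite -(psum_extend (sub_closed_nb G Z) (f := fun x => e x * v x * m x)); last first.
  by move=> x /v0 ->; rewrite mulr0 mul0r.
rewrite -psumZ -!psumN -!psumD; apply: eq_bigr => x _; ring.
Qed.

(* Comparison of [F x] with [s |-> h0 / (p (p + 1)) s^p], written with [s ^+ 2]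
   so that it is differentiable at [0]. *)
Lemma F_small x (s : R) : `|s| <= l0 -> F x s <= h0 / (p * (p + 1)) * `|s| `^ p.
Proof.
move=> sl; set C := h0 / _.
have C0 : 0 <= C by rewrite divr_ge0 ?mulr_ge0 ?addr_ge0 ?(ltW p_gt0) ?(ltW h0_gt0).
(* The factor [sg], equal to 1 or -1, reduces negative [s] to an argument on the half-line
   [t >= 0]. *)
have key sg : `|sg| = 1 -> forall t, 0 <= t -> t <= l0 -> F x (sg * t) <= C * `|t| `^ p.
  move=> sg1 t t0 tl.
  have r_ge1 : 1 <= p / 2 by rewrite ler_pdivlMr // mul1r.
  pose k t := C * (t ^+ 2) `^ (p / 2) - F x (sg * t).
  pose dk t := C * (p / 2 * (t ^+ 2) `^ (p / 2 - 1) * (2 * t)) - dF F x (sg * t) * sg.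
  have dk_ (t' : R) : is_derive t' 1 k (dk t').
    have Dq : is_derive t' 1 (fun t : R => t ^+ 2) (2 * t').
      by apply: is_derive_eq; rewrite /GRing.scale /=; ring.
    have Da : is_derive t' 1 (fun t : R => sg * t) sg.
      by apply: is_derive_eq; rewrite /GRing.scale /=; ring.
    have D1 := is_derive_powR_ge0 (fun t => sqr_ge0 t) Dq r_ge1.
    have D2 := @is_derive1_comp R (F x) (fun t : R => sg * t) t' _ _
      (is_derive_F x (sg * t')) Da.
    exact: (is_deriveB (is_deriveZ C D1) D2).
  have k0 : k 0 = 0.
    by rewrite /k mulr0 F0 expr0n /= powR0 ?mulr0 ?subr0 // gt_eqF // divr_gt0.
  rewrite normX2_powR -subr_ge0 -/(k t).
  move: t0; rewrite le_eqVlt => /predU1P[<-|t0]; first by rewrite k0.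
  (* The intermediate point satisfies [c < t <= l0], so the strict inequality in [c1] holds even
     when [|s| = l0], a value allowed on the sphere of radius [r0]. *)
  have [|c cI kE] := @MVT R k dk 0 t t0 (fun (y : R) _ => dk_ y).
    apply: continuous_subspaceT => t'.
    apply: differentiable_continuous; apply/derivable1_diffP.
    by have [] := dk_ t'.
  move: kE cI; rewrite k0 !subr0 in_itv /= => -> /andP[c0 ct].
  apply: mulr_ge0; last exact: ltW.
  have H : `|dF F x (sg * c)| <= h0 / (p + 1) * c `^ (p - 1).
    have := @c1 x (sg * c); rewrite normrM sg1 mul1r (gtr0_norm c0); apply.
    exact: lt_le_trans ct tl.
  have cc : (c ^+ 2) `^ (p / 2 - 1) * c = c `^ (p - 1).
    have -> : p / 2 - 1 = (p - 2) / 2 by rewrite mulrBl divff.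
    rewrite -normX2_powR (gtr0_norm c0) mulrC -(mulr_powRB1 (ltW c0) (_ : 0 < p - 1)) ?subr_gt0 //.
    by rewrite -addrA -opprD.
  have dc : dk c = h0 / (p + 1) * c `^ (p - 1) - dF F x (sg * c) * sg.
    rewrite /dk /C -cc; field.
    by rewrite !gt_eqF // addr_gt0.
  rewrite dc subr_ge0; apply: le_trans H.
  by rewrite (le_trans (ler_norm _)) // normrM sg1 mulr1.
have [s0|s0] := leP 0 s.
  have := key 1 (normr1 _) s s0; rewrite mul1r; apply.
  by rewrite -(ger0_norm s0).
have n1 : `|-1 : R| = 1 by rewrite normrN normr1.
have := key _ n1 (- s); rewrite mulN1r opprK normrN; apply.
- by rewrite oppr_ge0 ltW.
- by rewrite -(ltr0_norm s0).
Qed.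

Lemma E_ge0 : 0 <= E.
Proof. by apply: has_sum_ge0 e_sum => x; rewrite mulr_ge0 ?powR_ge0 // ltW. Qed.

Lemma psum_e_le S : psum (fun x => `|e x| `^ q * m x) S <= E.
Proof. by apply: psum_le_sum e_sum => x; rewrite mulr_ge0 ?powR_ge0 // ltW. Qed.

Lemma psum_u_le u S : psum (fun x => `|u x| `^ p * m x) S <= h0^-1 * psum (tdens u) S.
Proof.
rewrite -psumZ; apply: psum_le => x; rewrite ler_pdivlMl // mulrA ler_wpM2r ?(ltW (m_gt0 x)) //.
exact: dens_ge_u.
Qed.

(** Every vertex weighs at least [mu0] and [h] is at least [h0], so the norm controls each value of
    the function. *)
Lemma u_le_tdens u S x C : psum (tdens u) S <= C -> x \in S ->
  `|u x| `^ p <= (h0 * mu0)^-1 * C.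
Proof.
move=> H xS; rewrite ler_pdivlMl ?mulr_gt0 //; apply: le_trans H.
apply: le_trans (psum_mem (tdens0 u) xS).
exact: tdens_ge_u.
Qed.

(** Half of the coercivity left by (c3) after [A |s|^p] is absorbed into the norm; the other half
    absorbs the term in [e]. It is positive by the upper bound on [A]. *)
Let kappa := (nu / p - 1 - A / h0) / 2.

Lemma kappa_gt0 : 0 < kappa.
Proof. by rewrite divr_gt0 // subr_gt0 ltr_pdivrMr // mulrC. Qed.

(* [c3] is a condition of Ambrosetti-Rabinowitz type: it makes
   [nu * energy - <energy', u>] coercive, uniformly in the support [Z]. *)
Lemma ar_bound : exists2 C2, 0 <= C2 & forall u Z, (forall x, x \notin Z -> u x = 0) ->
  kappa * psum (tdens u) (closed_nb Z) <=
  nu * psum (edens u) (closed_nb Z) - psum (fun x => res u x * u x * m x) Z + C2.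
Proof.
have nu1 : 0 < nu - 1 by rewrite subr_gt0 (lt_trans _ nu_gt).
have k0 := kappa_gt0.
have c0 : 0 < eps * (nu - 1) by rewrite mulr_gt0.
(* The term in [e] has coefficient [nu] in [nu * energy] and 1 in the tested equation, whence
   [nu - 1]. The Young parameter turns its share of [|u|^p] into [kappa * h0 * |u|^p], at most
   [kappa * dens u]. *)
have [C C0 HC] := @young_eps R p (kappa * h0 / (eps * (nu - 1))) p_gt1
  (divr_gt0 (mulr_gt0 k0 h0_gt0) c0).
exists (eps * (nu - 1) * C * E); first by rewrite !mulr_ge0 ?E_ge0 // ltW.
move=> u Z u0.
have ext f : psum (fun x => f x * u x * m x) Z = psum (fun x => f x * u x * m x) (closed_nb Z).
  rewrite (psum_extend (sub_closed_nb G Z)) //.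
  by move=> x /u0 ->; rewrite mulr0 mul0r.
have bxx : psum (fun x => bil u u x * m x) (closed_nb Z) = psum (tdens u) (closed_nb Z).
  by apply: eq_bigr => x _; rewrite bilxx.
rewrite (psum_res _ u0) bxx.
rewrite (ext (fun x => dF F x (u x))) (ext e).
have pt x : kappa * tdens u x <= nu * edens u x - (tdens u x - dF F x (u x) * u x * m x
    - eps * (e x * u x * m x)) + eps * (nu - 1) * C * (`|e x| `^ q * m x).
  have H1 := c3 x (u x).
  have H2 := HC _ _ (normr_ge0 (e x)) (normr_ge0 (u x)).
  have H3 : h0 * `|u x| `^ p <= dens u x := dens_ge_u Glf p h_ge u x.
  have H4 : e x * u x <= `|e x| * `|u x| by rewrite -normrM ler_norm.
  have H5 := ler_wpM2l (ltW c0) (le_trans H4 H2).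
  have H6 : A * `|u x| `^ p <= A / h0 * dens u x.
    rewrite -mulrA ler_wpM2l // mulrC ler_pdivlMr // mulrC //.
  have H7 := ler_wpM2l (ltW k0) H3.
  have E5 : eps * (nu - 1) * (kappa * h0 / (eps * (nu - 1)) * `|u x| `^ p + C * `|e x| `^ q)
    = kappa * (h0 * `|u x| `^ p) + eps * (nu - 1) * C * `|e x| `^ q.
    by field; rewrite !gt_eqF.
  rewrite E5 in H5.
  have E8 : nu / p = 2 * kappa + 1 + A / h0 by rewrite /kappa; field; rewrite !gt_eqF.
  rewrite /edens /tdens -subr_ge0.
  have -> : nu * ((p^-1 * dens u x - F x (u x) - eps * (e x * u x)) * m x) -
     (dens u x * m x - dF F x (u x) * u x * m x - eps * (e x * u x * m x)) +
     eps * (nu - 1) * C * (`|e x| `^ q * m x) - kappa * (dens u x * m x) =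
     ((nu / p) * dens u x - dens u x - kappa * dens u x - (nu * F x (u x) - dF F x (u x) * u x)
      - eps * (nu - 1) * (e x * u x) + eps * (nu - 1) * C * `|e x| `^ q) * m x by ring.
  rewrite mulr_ge0 ?(ltW (m_gt0 x)) // E8.
  move: H1 H5 H6 H7; lra.
have := psum_le (closed_nb Z) pt.
rewrite psumZ !psumD psumN !psumD !psumN !psumZ => /le_trans; apply.
rewrite lerD //.
by rewrite ler_wpM2l ?psum_e_le // !mulr_ge0 // ltW.
Qed.

(** The first entry forces [|u| <= l0] on the sphere of radius [r0], so that (c1) applies; the
    second makes it easy to place a multiple of the Dirac function outside. *)
Let r0 := Num.min (l0 * (h0 * mu0) `^ p^-1) 1.

Hypothesis eps_lt : eps < r0 `^ (p - 1) / ((p + 1) * h0 `^ (- p^-1) * E `^ q^-1).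

Lemma r0_gt0 : 0 < r0.
Proof. by rewrite lt_min ltr01 mulr_gt0 // powR_gt0 // mulr_gt0. Qed.

(** By [F_small] the term in [F] costs [1 / (p (p + 1))] of the norm, which leaves
    [1 / p - 1 / (p (p + 1)) = 1 / (p + 1)]. Hoelder's inequality bounds the term in [e] by
    [eps * E]^ q^-1 * h0 [^ (- p^-1) * r0]. The difference is positive exactly under [eps_lt]. *)
Lemma sphere_bound : exists2 al, 0 < al & forall u Z,
  (forall x, x \notin Z -> u x = 0) ->
  psum (tdens u) (closed_nb Z) = r0 `^ p -> al <= psum (edens u) (closed_nb Z).
Proof.
have r0p := r0_gt0; move: eps_lt => lt_eps.
set N := E `^ q^-1 in lt_eps *.
have pm : 0 < p - 1 by rewrite subr_gt0.
have p1 : 0 < p + 1 by rewrite addr_gt0.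
have q0 : 0 < q by rewrite divr_gt0.
(* If [N] were 0, the bound in [eps_lt] would be a division by 0, whose value is 0, against
   [0 < eps]. *)
have N0 : 0 < N.
  rewrite lt_neqAle powR_ge0 andbT; apply/eqP => N0.
  by move: lt_eps; rewrite -N0 mulr0 invr0 mulr0 ltNge (ltW eps_gt0).
have E0 : 0 < E.
  by apply: (gt0_powR (x := q^-1)) => //; rewrite ?invr_gt0 // E_ge0.
set H := h0 `^ (- p^-1) in lt_eps *.
have H0 : 0 < H by rewrite powR_gt0.
exists (r0 * (r0 `^ (p - 1) / (p + 1) - eps * N * H)).
  rewrite mulr_gt0 // subr_gt0.
  move: lt_eps; rewrite ltr_pdivlMr ?mulr_gt0 // => Hlt.
  rewrite ltr_pdivlMr //.
  by have -> : eps * N * H * (p + 1) = eps * ((p + 1) * H * N) by ring.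
move=> u Z u0 nZ; set Y := closed_nb Z in nZ *.
have r0pp : 0 < r0 `^ p by rewrite powR_gt0.
have ul x : `|u x| <= l0.
  have [xZ|xZ] := boolP (x \in Y); last first.
    rewrite u0 ?normr0 ?(ltW l0_gt0) //.
    by apply: contra xZ; exact/fsubsetP/sub_closed_nb.
  have := @u_le_tdens u Y x (r0 `^ p); rewrite nZ lexx => /(_ isT xZ).
  rewrite ler_pdivlMl ?mulr_gt0 // => H1.
  have H2 : r0 `^ p <= (h0 * mu0) * l0 `^ p.
    apply: (@le_trans _ _ ((l0 * (h0 * mu0) `^ p^-1) `^ p)).
      apply: ge0_ler_powR; rewrite ?nnegrE ?(ltW p_gt0) ?(ltW r0p) ?mulr_ge0 ?powR_ge0 ?(ltW l0_gt0) //.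
      by rewrite /r0 ge_min lexx.
    rewrite powRM ?powR_ge0 ?(ltW l0_gt0) // -powRrM mulVf ?gt_eqF // powRr1 ?mulr_ge0 ?(ltW h0_gt0) ?(ltW mu0_gt0) //.
    by rewrite mulrC.
  have H3 : `|u x| `^ p <= l0 `^ p by rewrite -(ler_pM2l (mulr_gt0 h0_gt0 mu0_gt0)) (le_trans H1).
  rewrite leNgt; apply/negP => H4; move: H3; rewrite leNgt => /negP; apply.
  by apply: gt0_ltr_powR => //; rewrite nnegrE // ltW.
have Hh := @hoelder_psum R V e u m p E (h0^-1 * r0 `^ p) Y p_gt1 E0 _ (fun x => ltW (m_gt0 x)) (psum_e_le Y).
have {}Hh : psum (fun x => `|e x * u x| * m x) Y <= N * (r0 * H).
  apply: le_trans (Hh _ _) _.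
  - by rewrite mulr_gt0 // invr_gt0.
  - by apply: le_trans (psum_u_le u Y) _; rewrite nZ.
  - rewrite powRM ?invr_ge0 ?(ltW h0_gt0) ?(ltW r0pp) // -powRrM mulfV ?gt_eqF // powRr1 ?(ltW r0p) //.
    have -> : h0^-1 `^ p^-1 = H by rewrite /H -(powR_inv1 (ltW h0_gt0)) -powRrM mulN1r.
    by rewrite (mulrC H).
have pt x : (p + 1)^-1 * tdens u x - eps * (`|e x * u x| * m x) <= edens u x.
  rewrite /tdens /edens -subr_ge0.
  have -> : (p^-1 * dens u x - F x (u x) - eps * (e x * u x)) * m x -
    ((p + 1)^-1 * (dens u x * m x) - eps * (`|e x * u x| * m x)) =
    ((p^-1 - (p + 1)^-1) * dens u x - F x (u x) + eps * (`|e x * u x| - e x * u x)) * m x by ring.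
  rewrite mulr_ge0 ?(ltW (m_gt0 x)) // addr_ge0 //; last first.
    by rewrite mulr_ge0 ?(ltW eps_gt0) // subr_ge0 ler_norm.
  rewrite subr_ge0; apply: le_trans (F_small x (ul x)) _.
  have -> : p^-1 - (p + 1)^-1 = (p * (p + 1))^-1 by field; rewrite !gt_eqF.
  rewrite mulrAC mulrC ler_wpM2l ?invr_ge0 ?mulr_ge0 ?(ltW p_gt0) ?(ltW p1) //.
  exact: dens_ge_u.
have := psum_le Y pt; rewrite psumD psumN !psumZ nZ; apply: le_trans.
have H1 := ler_wpM2l (ltW eps_gt0) Hh.
have -> : r0 * (r0 `^ (p - 1) / (p + 1) - eps * N * H) =
  (p + 1)^-1 * (r0 * r0 `^ (p - 1)) - eps * (N * (r0 * H)) by ring.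
by rewrite mulr_powRB1 ?(ltW r0p) // lerD2l lerN2.
Qed.

Section Limits.
Variables (I : Type) (U : set_system I) (FU : ProperFilter U).
Variables (u : I -> V -> R) (u_ : V -> R).
Hypothesis cvu : forall x, u i x @[i --> U] --> u_ x.

Lemma cvg_F x : F x (u i x) @[i --> U] --> F x (u_ x).
Proof. exact: (cvg_continuous FU (@F_continuous x) (@cvu x)). Qed.

Lemma cvg_dF x : dF F x (u i x) @[i --> U] --> dF F x (u_ x).
Proof. exact: (cvg_continuous FU (proj2 (F_C1 x)) (@cvu x)). Qed.

Lemma cvg_edens x : edens (u i) x @[i --> U] --> edens u_ x.
Proof.
apply: cvgM; last exact: cvg_cst.
apply: cvgB; last by apply: cvgM; [exact: cvg_cst|apply: cvgM => //; exact: cvg_cst].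
apply: cvgB; last exact: cvg_F.
by apply: cvgM; [exact: cvg_cst|exact: cvg_dens].
Qed.

Lemma cvg_res x : res (u i) x @[i --> U] --> res u_ x.
Proof.
apply: cvgB; last exact: cvg_cst.
apply: cvgB; last exact: cvg_dF.
apply: cvgD; first by apply: cvgN; exact: cvg_plaplacian.
apply: cvgM => //; apply: cvgM; first exact: cvg_cst.
apply: cvg_powR => //; last by rewrite subr_ge0.
exact: cvg_norm.
Qed.

End Limits.

(** * Dirac functions and their energies *)

Definition delta x : V -> R := fun y => (y == x)%:R.

Lemma psum1 (f : V -> R) x : psum f [fset x]%fset = f x.
Proof. exact: big_seq_fset1. Qed.

Lemma energy_delta x Z (t : R) : x \in Z -> 0 <= t ->
  psum (edens (fun y => t * delta x y)) (closed_nb Z) =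
  t `^ p * (p^-1 * psum (tdens (delta x)) (closed_nb Z))
  - F x t * m x - eps * (e x * t) * m x.
Proof.
move=> xZ t0.
have xY : ([fset x] `<=` closed_nb Z)%fset.
  by rewrite fsub1set; exact: (fsubsetP (sub_closed_nb G Z)).
have dx : delta x x = 1 by rewrite /delta eqxx.
have dy y : y \notin [fset x]%fset -> delta x y = 0.
  by rewrite inE /delta => /negbTE ->.
have E1 : psum (fun y => F y (t * delta x y) * m y) (closed_nb Z) = F x t * m x.
  rewrite (psum_extend xY) ?psum1 ?dx ?mulr1 // => y /dy ->.
  by rewrite mulr0 F0 mul0r.
have E2 : psum (fun y => e y * (t * delta x y) * m y) (closed_nb Z) = e x * t * m x.
  rewrite (psum_extend xY) ?psum1 ?dx ?mulr1 // => y /dy ->.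
  by rewrite !mulr0 mul0r.
rewrite -E1 -mulrA -E2 -!psumZ -!psumN -!psumD; apply: eq_bigr => y _.
by rewrite /edens /tdens densZ (ger0_norm t0); ring.
Qed.

(** The origin of [D1]: the squared gradient of the Dirac function at [y] is at most
    [deg x / (2 m y)] and vanishes unless [y] is [x] or a neighbour. Its power [p / 2] times [m y]
    gives [(deg x / 2)^(p / 2) * (1 / m y)^(p / 2 - 1)]. *)
Lemma delta_norm_le x Z : x \in Z ->
  psum (tdens (delta x)) (closed_nb Z) <= D1 G p x + m x * h x.
Proof.
move=> xZ; have r_gt0 : 0 < p / 2 by rewrite divr_gt0.
have xY : ([fset x] `<=` closed_nb Z)%fset.
  by rewrite fsub1set; exact: (fsubsetP (sub_closed_nb G Z)).
have dx : delta x x = 1 by rewrite /delta eqxx.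
have dy y : y != x -> delta x y = 0 by rewrite /delta => /negbTE ->.
pose f1 y := gsq G (delta x) y `^ (p / 2) * m y.
pose f2 y := h y * (delta x y ^+ 2) `^ (p / 2) * m y.
have -> : psum (tdens (delta x)) (closed_nb Z) =
    psum f1 (closed_nb Z) + psum f2 (closed_nb Z).
  by rewrite -psumD; apply: eq_bigr => y _; rewrite /tdens /dens mulrDl.
have -> : psum f2 (closed_nb Z) = m x * h x.
  rewrite (psum_extend xY) ?psum1.
    by rewrite /f2 dx expr1n powR1 mulr1 mulrC.
  by move=> y; rewrite inE => /dy yx; rewrite /f2 yx expr0n /= powR0 ?gt_eqF // mulr0 mul0r.
rewrite lerD2r.
have degE : deg G x = \sum_(y <- nb G x) wt G x y.
  rewrite /deg sum_nbhd // big_seq [RHS]big_seq.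
  by apply: eq_bigr => y yx; rewrite wt_nb.
have deg0 : 0 <= deg G x by rewrite degE; apply: sumr_ge0 => y _; exact: wt_ge0.
have gsq_le y : gsq G (delta x) y <= deg G x / 2 * (m y)^-1.
  have -> : deg G x / 2 * (m y)^-1 = (2 * m y)^-1 * deg G x.
    by field; rewrite gt_eqF.
  rewrite /gsq ler_wpM2l ?(ltW (meas2_gt0 G y)) // degE.
  have [->|yx] := eqVneq y x.
    apply: ler_sum => z _; rewrite ler_piMr ?wt_ge0 // dx.
    have [->|zx] := eqVneq z x; first by rewrite dx subrr expr0n.
    by rewrite dy // sub0r sqrrN expr1n.
  rewrite (dy _ yx).
  (* For [y] other than [x], only the edge joining [y] to [x] sees a difference, and its weight is
     one of the terms of [deg x]. *)
  apply: (@le_trans _ _ (wt G y x)).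
    have [xy|xy] := boolP (x \in nb G y); last first.
      rewrite big1_seq ?wt_ge0 // => z /andP[_ zy].
      rewrite dy ?subrr ?expr0n ?mulr0 //.
      by apply: contraNneq xy => <-.
    rewrite (big_fsetD1 x) //= dx subr0 expr1n mulr1 big1_seq ?addr0 // => z.
    by rewrite in_fsetD1 => /and3P[_ zx _]; rewrite dy // subrr expr0n mulr0.
  rewrite wt_sym; have [yn|yn] := boolP (y \in nb G x); last first.
    by rewrite wt_nb0 //; apply: sumr_ge0 => z _; exact: wt_ge0.
  rewrite (big_fsetD1 y) //= lerDl.
  by apply: sumr_ge0 => z _; exact: wt_ge0.
pose K y := (deg G x / 2) `^ (p / 2) * (m y)^-1 `^ (p / 2 - 1).
have K0 y : 0 <= K y by rewrite mulr_ge0 ?powR_ge0.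
have f1K y : f1 y <= K y.
  have mi : 0 <= (m y)^-1 by rewrite invr_ge0 ltW.
  have d2 : 0 <= deg G x / 2 by rewrite divr_ge0.
  apply: (@le_trans _ _ ((deg G x / 2 * (m y)^-1) `^ (p / 2) * m y)).
    rewrite ler_wpM2r ?(ltW (m_gt0 y)) //.
    by apply: ge0_ler_powR; rewrite ?nnegrE ?gsq_ge0 ?mulr_ge0 // ltW.
  rewrite powRM // -(mulr_powRB1 mi r_gt0) /K -!mulrA [_ `^ _ * m y]mulrC.
  by rewrite mulKf ?gt_eqF.
pose J := (x |` nb G x)%fset.
have JY : (J `<=` closed_nb Z)%fset.
  by rewrite fsubUset xY nb_closed_nb.
rewrite (psum_extend JY); last first.
  move=> y; rewrite !inE negb_or => /andP[yx yn].
  rewrite /f1 (_ : gsq _ _ _ = 0) ?powR0 ?gt_eqF ?mul0r //.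
  rewrite /gsq big1_seq ?mulr0 // => z /andP[_ zy].
  rewrite (dy y) // dy ?subrr ?expr0n ?mulr0 //.
  by apply: contraNneq yn => zx; rewrite mem_nb // adj_sym -(mem_nb Glf) -zx.
apply: (@le_trans _ _ (psum K J)); first exact: psum_le.
(* If [x] carries a loop, [D1] counts [x] twice; an inequality is enough. *)
rewrite (psum_split _ [fset x]%fset J) /D1 mulrDr addrC lerD //.
  rewrite sum_nbhd // mulr_sumr; apply: psum_subset => //.
  by apply/fsubsetP => y; rewrite !inE => /andP[/negbTE ->].
by rewrite (_ : (_ `&` _)%fset = [fset x]%fset) ?psum1 //; apply/fsetIidPr; exact: fsubsetUl.
Qed.

Lemma delta_norm_ge x Z : x \in Z -> h0 * mu0 <= psum (tdens (delta x)) (closed_nb Z).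
Proof.
move=> xZ; apply: le_trans (psum_mem (tdens0 _) (_ : x \in _)); last first.
  exact: (fsubsetP (sub_closed_nb G Z)).
apply: le_trans (tdens_ge_u Glf p mu0_gt0 meas_ge h0_gt0 h_ge (delta x) x).
by rewrite /delta eqxx normr1 powR1 mulr1.
Qed.

(** * Functions supported in [Z] as row vectors *)

Section FiniteDim.
Variables (x0 : V) (Z : {fset V}).
Local Notation n := #|` Z|.
Local Notation pt i := (nth x0 (enum_fset Z) i).

Definition ext (r : 'rV[R]_n) x : R := \sum_(i < n) r ord0 i * (x == pt i)%:R.

Definition rst u : 'rV[R]_n := \row_i u (pt i).

Lemma ext_pt r (i : 'I_n) : ext r (pt i) = r ord0 i.
Proof.
rewrite /ext (bigD1 i) //= eqxx mulr1 big1 ?addr0 // => j ji.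
by rewrite nth_uniq ?fset_uniq // (negbTE (_ : i != j :> nat)) ?mulr0 // eq_sym.
Qed.

Lemma ext_supp r x : x \notin Z -> ext r x = 0.
Proof.
move=> xZ; rewrite /ext big1 // => i _; rewrite (_ : x == _ = false) ?mulr0 //.
by apply: contraNF xZ => /eqP ->; exact: mem_nth.
Qed.

Lemma pt_index x : x \in Z -> exists i : 'I_n, x = pt i.
Proof.
move=> xZ; have ix : (index x (enum_fset Z) < n)%N by rewrite index_mem.
by exists (Ordinal ix); rewrite /= nth_index.
Qed.

Lemma pt_mem (i : 'I_n) : pt i \in Z.
Proof. exact: mem_nth. Qed.

Lemma ext_rst u : (forall x, x \notin Z -> u x = 0) -> ext (rst u) = u.
Proof.
move=> u0; apply/funext => x; have [xZ|xZ] := boolP (x \in Z); last first.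
  by rewrite ext_supp // u0.
by have [i ->] := pt_index xZ; rewrite ext_pt mxE.
Qed.

Lemma extD r r' (s : R) : ext (r + s *: r') = fun x => ext r x + s * ext r' x.
Proof.
apply/funext => x; rewrite /ext mulr_sumr -big_split; apply: eq_bigr => i _ /=.
by rewrite !mxE; ring.
Qed.

Lemma extZ r (s : R) : ext (s *: r) = fun x => s * ext r x.
Proof.
apply/funext => x; rewrite /ext mulr_sumr; apply: eq_bigr => i _ /=.
by rewrite !mxE mulrA.
Qed.

Lemma psum_pt (f : V -> R) : psum f Z = \sum_(i < n) f (pt i).
Proof. by rewrite /psum (big_nth x0) big_mkord. Qed.

Lemma cvg_ext (r : 'rV[R]_n) x : ext r' x @[r' --> r] --> ext r x.
Proof.
apply: (cvg_sumr (nbhs_pfilter r)) => i.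
by apply: (cvg_mulr_cst (nbhs_pfilter r)); exact: coord_continuous.
Qed.

Definition fenergy (r : 'rV[R]_n) := psum (edens (ext r)) (closed_nb Z).
Definition fnorm (r : 'rV[R]_n) := psum (tdens (ext r)) (closed_nb Z).
Definition fgrad (r : 'rV[R]_n) : 'rV[R]_n := \row_i (res (ext r) (pt i) * m (pt i)).

Lemma fenergy_continuous : continuous fenergy.
Proof.
move=> r; apply: (cvg_sumr (nbhs_pfilter r)) => x.
exact: (@cvg_edens _ (nbhs r) (nbhs_pfilter r) ext (ext r) (@cvg_ext r) x).
Qed.

Lemma fnorm_continuous : continuous fnorm.
Proof.
move=> r; apply: (cvg_sumr (nbhs_pfilter r)) => x.
exact: (@cvg_tdens _ _ G p h p_ge2 _ (nbhs r) (nbhs_pfilter r) ext (ext r) (@cvg_ext r) x).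
Qed.

Lemma fgrad_continuous : continuous fgrad.
Proof.
apply: rV_continuous => i r; rewrite /fgrad.
under eq_fun do rewrite mxE.
apply: (cvg_mulr_cst (nbhs_pfilter r)); exact: (@cvg_res _ (nbhs r) (nbhs_pfilter r) ext (ext r) (@cvg_ext r) (pt i)).
Qed.

Lemma is_derive_fenergy (r w : 'rV[R]_n) (t : R) :
  is_derive t 1 (fun s : R => fenergy (r + s *: w))
    (\sum_i fgrad (r + t *: w) ord0 i * w ord0 i).
Proof.
have := is_derive_energy (ext r) t (@ext_supp w).
congr (is_derive _ _ _ _).
  by apply/funext => s; rewrite /fenergy extD.
rewrite psum_pt; apply: eq_bigr => i _.
by rewrite mxE ext_pt -extD; ring.
Qed.

Lemma fgrad_eq0 (r : 'rV[R]_n) : fgrad r = 0 -> forall x, x \in Z -> res (ext r) x = 0.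
Proof.
move=> /rowP g0 x /pt_index[i ->]; have := g0 i; rewrite !mxE => /eqP.
by rewrite mulf_eq0 (gt_eqF (m_gt0 _)) orbF => /eqP.
Qed.

Lemma fnorm_coord (r : 'rV[R]_n) i : `|r ord0 i| <= 1 + (h0 * mu0)^-1 * fnorm r.
Proof.
apply: le_trans (le1_add_powR (normr_ge0 _) (ltW p_gt1)) _.
rewrite lerD2l -ext_pt; apply: (u_le_tdens (lexx _)).
exact/(fsubsetP (sub_closed_nb G Z))/pt_mem.
Qed.

Lemma fnorm_ge0 (r : 'rV[R]_n) : 0 <= fnorm r.
Proof. exact: psum_ge0. Qed.

Lemma fnorm_bounded (r : 'rV[R]_n) (K : R) : fnorm r <= K -> `|r| <= 1 + (h0 * mu0)^-1 * K.
Proof.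
move=> rK; have hm : 0 <= (h0 * mu0)^-1 by rewrite invr_ge0 mulr_ge0 // ltW.
apply: norm_rV_le => [|i].
  by rewrite addr_ge0 // mulr_ge0 // (le_trans _ rK) // fnorm_ge0.
by apply: le_trans (fnorm_coord r i) _; rewrite lerD2l ler_wpM2l.
Qed.

Lemma psum_res_ext (r : 'rV[R]_n) : psum (fun x => res (ext r) x * ext r x * m x) Z =
  \sum_i fgrad r ord0 i * r ord0 i.
Proof. by rewrite psum_pt; apply: eq_bigr => i _; rewrite mxE ext_pt; ring. Qed.

End FiniteDim.

(** * Critical points of the energy on a finite set *)

Lemma delta_supp (t : R) x Z : x \in Z -> forall y, y \notin Z -> t * delta x y = 0.
Proof.
move=> xZ y yZ; rewrite /delta (_ : y == x = false) ?mulr0 //.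
by apply: contraNF yZ => /eqP ->.
Qed.

Lemma ext_delta (x0 x : V) Z (s t : R) : x \in Z ->
  ext x0 (s *: rst x0 Z (fun y => t * delta x y)) = fun y => s * t * delta x y.
Proof.
move=> xZ; rewrite extZ ext_rst; last exact: delta_supp.
by apply/funext => y; rewrite mulrA.
Qed.

Lemma ext0 (x0 : V) Z : ext x0 (0 : 'rV[R]_(#|` Z|)) = fun=> 0.
Proof. by apply/funext => x; rewrite /ext big1 // => i _; rewrite mxE mul0r. Qed.

Lemma tdens_cst0 x : tdens (fun=> 0) x = 0.
Proof.
by apply: (@tdens_supp _ _ _ Glf p h p_ge2 fset0) => //; rewrite /closed_nb fset0U big_seq_fset0.
Qed.

Lemma fnorm0 (x0 : V) Z : fnorm x0 (0 : 'rV[R]_(#|` Z|)) = 0.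
Proof. by rewrite /fnorm ext0 /psum big1 // => x _; exact: tdens_cst0. Qed.

Lemma fenergy0 (x0 : V) Z : fenergy x0 (0 : 'rV[R]_(#|` Z|)) = 0.
Proof.
rewrite /fenergy ext0 /psum big1 // => x _; rewrite /edens F0 subr0 !mulr0 subr0.
by rewrite -mulrA -/(tdens _ x) tdens_cst0 mulr0.
Qed.

Lemma r0p_gt0 : 0 < r0 `^ p.
Proof. by rewrite powR_gt0 // r0_gt0. Qed.

Lemma r0p_le1 : r0 `^ p <= 1.
Proof.
have -> : 1 = 1 `^ p :> R by rewrite powR1.
apply: ge0_ler_powR; rewrite ?nnegrE ?(ltW p_gt0) ?(ltW r0_gt0) //.
by rewrite /r0 ge_min lexx orbT.
Qed.

(** The constants [al] and [C] precede [Z]: [al] comes from the sphere, and [C] from a segment of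
    multiples of one Dirac function, whose energy is bounded in terms of the star of [x2] alone. *)
Lemma critical_mp (x2 : V) (l1 M : R) : 0 < l1 -> 0 < e x2 ->
  (D1 G p x2 + m x2 * h x2) / (p * m x2) < M ->
  (forall s, l1 < s -> M * s `^ p <= F x2 s) ->
  exists al C : R, 0 < al /\ forall Z, x2 \in Z -> exists u,
    [/\ forall x, x \notin Z -> u x = 0, forall x, x \in Z -> res u x = 0
      & al <= psum (edens u) (closed_nb Z) <= C].
Proof.
move=> l1_gt0 e_x2 M_gt c2.
have [al al0 Hal] := sphere_bound.
have hm : 0 < h0 * mu0 by rewrite mulr_gt0.
pose t0 := l1 + 1 + (h0 * mu0)^-1.
have t01 : 1 <= t0.
  by rewrite /t0 -addrA addrCA lerDl addr_ge0 ?(ltW l1_gt0) ?invr_ge0 ?(ltW hm).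
have t00 : 0 < t0 by apply: lt_le_trans t01.
have t0l : l1 < t0 by rewrite /t0 -addrA ltrDl addr_gt0 // invr_gt0.
have t0h : 1 < h0 * mu0 * t0.
  by rewrite /t0 mulrDr mulfV ?gt_eqF // ltrDr mulr_gt0 // addr_gt0.
have [M' M'0 HM'] := F_bounded t0.
have [C2 C20 AR] := ar_bound.
pose D := D1 G p x2 + m x2 * h x2.
pose C := t0 `^ p * (p^-1 * D) + M' * b x2 * m x2.
have nu0 : 0 < nu by apply: lt_trans nu_gt.
have D0 Z : x2 \in Z -> 0 <= D.
  by move=> xZ; apply: le_trans (delta_norm_le xZ); exact: psum_ge0.
have en_le Z t : x2 \in Z -> 0 <= t ->
    psum (edens (fun y => t * delta x2 y)) (closed_nb Z) <=
    t `^ p * (p^-1 * D) - F x2 t * m x2.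
  move=> xZ t_ge0; rewrite energy_delta //.
  have H1 : t `^ p * (p^-1 * psum (tdens (delta x2)) (closed_nb Z)) <= t `^ p * (p^-1 * D).
    rewrite ler_wpM2l ?powR_ge0 // ler_wpM2l ?invr_ge0 ?(ltW p_gt0) //.
    exact: delta_norm_le.
  have H2 : 0 <= eps * (e x2 * t) * m x2.
    by rewrite !mulr_ge0 ?(ltW eps_gt0) ?(ltW e_x2) ?(ltW (m_gt0 _)).
  by lra.
exists al, C; split => // Z xZ.
pose n := #|` Z|.
pose w : 'rV[R]_n := rst x2 Z (fun y => t0 * delta x2 y).
have k2 : 0 < kappa / 2 := divr_gt0 kappa_gt0 (ltr0n R 2).
have sg0 : 0 < kappa * (h0 * mu0) / 2 := divr_gt0 (mulr_gt0 kappa_gt0 hm) (ltr0n R 2).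
(* With [|g| <= kappa * (h0 * mu0) / 2] in the sup norm, the tested residual is at most a constant
   plus half of [kappa * fnorm], which [ar_bound] absorbs. The resulting bound depends on [Z]
   through [n]; it serves only for compactness, and the uniform bound is drawn later from exact
   critical points. *)
have [|||||||r gr0 Hr] := @mountain_pass R n (@fenergy x2 Z) (@fnorm x2 Z) (@fgrad x2 Z)
  (@fenergy_continuous x2 Z) (@fnorm_continuous x2 Z) (@fgrad_continuous x2 Z)
  (@is_derive_fenergy x2 Z) w (r0 `^ p) al C (kappa * (h0 * mu0) / 2)
  (1 + (h0 * mu0)^-1 * ((nu * C + C2 + kappa * (h0 * mu0) / 2 * n%:R) / (kappa / 2)))
  al0 sg0.
- by rewrite fenergy0.
- rewrite -[w]scale1r /fenergy ext_delta // mul1r.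
  apply: le_trans (en_le Z t0 xZ (ltW t00)) _.
  (* Here the size of [M] enters: [D / p <= M * m x2] makes the energy at the end of the path
     nonpositive. *)
  have H := c2 t0 t0l; rewrite subr_le0.
  apply: (@le_trans _ _ (M * t0 `^ p * m x2)); last by rewrite ler_wpM2r // ltW.
  rewrite [M * _]mulrC -mulrA ler_wpM2l ?powR_ge0 // ler_pdivrMl //.
  move: M_gt; rewrite ltr_pdivrMr ?mulr_gt0 // => /ltW.
  by rewrite mulrCA.
- by rewrite fnorm0 r0p_gt0.
- rewrite -[w]scale1r /fnorm ext_delta // mul1r.
  have -> : psum (tdens (fun y => t0 * delta x2 y)) (closed_nb Z) =
      t0 `^ p * psum (tdens (delta x2)) (closed_nb Z).
    rewrite -psumZ; apply: eq_bigr => y _.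
    by rewrite /tdens densZ (gtr0_norm t00) mulrA.
  apply: (le_lt_trans r0p_le1).
  apply: (@lt_le_trans _ _ (t0 `^ p * (h0 * mu0))).
    apply: (lt_le_trans t0h); rewrite mulrC ler_wpM2r ?(ltW hm) //.
    by apply: le1r_powR => //; exact: ltW.
  by rewrite ler_wpM2l ?powR_ge0 // delta_norm_ge.
- move=> r Nr; apply: Hal => //.
  by move=> x; exact: ext_supp.
- move=> s /andP[s0 s1]; rewrite /fenergy ext_delta //.
  have st0 : 0 <= s * t0 by rewrite mulr_ge0 // ltW.
  have stt : s * t0 <= t0 by rewrite ler_piMl // ltW.
  apply: le_trans (en_le Z _ xZ st0) _.
  have n1 : `|s * t0| <= t0 by rewrite ger0_norm.
  have [H1 _] := HM' x2 _ n1.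
  have H2 : - F x2 (s * t0) * m x2 <= M' * b x2 * m x2.
    rewrite ler_wpM2r ?(ltW (m_gt0 _)) //; apply: le_trans H1.
    by rewrite -normrN ler_norm.
  rewrite /C -mulNr lerD // ler_wpM2r ?mulr_ge0 ?invr_ge0 ?(ltW p_gt0) ?(D0 Z) //.
  by apply: ge0_ler_powR; rewrite ?nnegrE ?(ltW p_gt0) ?(ltW t00).
- move=> r /andP[_ rC] gr; apply: fnorm_bounded.
  rewrite ler_pdivlMr //.
  have := AR (ext x2 r) Z (@ext_supp x2 Z r).
  rewrite psum_res_ext -/(fnorm _ _) -/(fenergy _ _).
  have H1 : - \sum_i fgrad x2 r ord0 i * r ord0 i <=
      kappa * (h0 * mu0) / 2 * (n%:R + (h0 * mu0)^-1 * fnorm x2 r).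
    apply: (@le_trans _ _ (\sum_(i < n) kappa * (h0 * mu0) / 2 * (1 + `|r ord0 i| `^ p))).
      rewrite -sumrN; apply: ler_sum => i _.
      apply: le_trans (ler_norm _) _; rewrite normrN normrM.
      apply: ler_pM => //; first by apply: le_trans gr; exact: norm_rV_ge.
      exact: le1_add_powR (normr_ge0 _) (ltW p_gt1).
    rewrite -mulr_sumr ler_wpM2l ?(ltW sg0) //.
    rewrite big_split /= sumr_const card_ord lerD2l.
    have -> : \sum_(i < n) `|r ord0 i| `^ p = psum (fun x => `|ext x2 r x| `^ p) Z.
      by rewrite (psum_pt x2); apply: eq_bigr => i _; rewrite ext_pt.
    apply: (@le_trans _ _ (psum (fun x => `|ext x2 r x| `^ p) (closed_nb Z))).
      by apply: psum_subset; [move=> x; exact: powR_ge0|exact: sub_closed_nb].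
    rewrite /fnorm -psumZ; apply: psum_le => x.
    rewrite ler_pdivlMl //; exact: tdens_ge_u.
  have H2 := ler_wpM2l (ltW nu0) rC.
  have E1 : kappa * (h0 * mu0) / 2 * (n%:R + (h0 * mu0)^-1 * fnorm x2 r) =
    kappa * (h0 * mu0) / 2 * n%:R + kappa / 2 * fnorm x2 r.
    by field; rewrite !gt_eqF.
  rewrite E1 in H1.
  have E2 : kappa * fnorm x2 r = fnorm x2 r * (kappa / 2) + kappa / 2 * fnorm x2 r by field.
  rewrite E2; move: H1 H2; lra.
exists (ext x2 r); split => //.
- by move=> x; exact: ext_supp.
- exact: fgrad_eq0.
Qed.

(** Along a small multiple of the Dirac function at [x3], the linear term with [e x3 > 0] beats the
    [p]-th power, so the energy takes a negative value. On the sphere it is positive, so the minimum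
    over the ball is interior. The lower bound [- C] is [ar_bound] at a critical point. *)
Lemma critical_min (x3 : V) (l2 : R) : 0 < l2 -> 0 < e x3 ->
  (forall s, 0 < s -> s < l2 -> 0 <= F x3 s) ->
  exists c C : R, 0 < c /\ forall Z, x3 \in Z -> exists u,
    [/\ forall x, x \notin Z -> u x = 0, forall x, x \in Z -> res u x = 0
      & - C <= psum (edens u) (closed_nb Z) <= - c].
Proof.
move=> l2_gt0 e_x3 c4.
have [al al0 Hal] := sphere_bound.
have [C2 C20 AR] := ar_bound.
have nu0 : 0 < nu by apply: lt_trans nu_gt.
have hm : 0 < h0 * mu0 by rewrite mulr_gt0.
pose D := D1 G p x3 + m x3 * h x3.
have D0 : 0 <= D.
  by apply: le_trans (delta_norm_le (fset11 x3)); exact: psum_ge0.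
have D1_gt0 : 0 < D + 1 by lra.
pose k := eps * e x3 * m x3.
have k0 : 0 < k by rewrite !mulr_gt0.
(* The first entry keeps the test function in the ball; the second lets the norm term use at most
   half of the gain [s * k] of the linear term. *)
pose B := Num.min (r0 `^ p) (k * p / 2).
have B0 : 0 < B by rewrite lt_min r0p_gt0 divr_gt0 ?mulr_gt0.
(* For [s <= 1] and [p >= 2], [s^p <= s^2], so that a bound on [s * (D + 1)] suffices; [D + 1]
   replaces [D] to allow division. *)
pose s := Num.min 1 (Num.min (l2 / 2) (B / (D + 1) / 2)).
have s0 : 0 < s by rewrite !lt_min ltr01 !divr_gt0.
have s1 : s <= 1 by rewrite ge_min lexx.
have sl2 : s < l2.
  apply: (@le_lt_trans _ _ (l2 / 2)); first by rewrite /s !ge_min lexx orbT.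
  by lra.
have sB : s * (D + 1) < B.
  apply: (@le_lt_trans _ _ (B / 2)); last by lra.
  rewrite -ler_pdivlMr // mulrAC /s !ge_min lexx !orbT //.
have spD : s `^ p * D <= s * (s * (D + 1)).
  rewrite -(mulr_powRB1 (ltW s0) p_gt0) -mulrA ler_wpM2l ?(ltW s0) //.
  apply: ler_pM => //; [exact: powR_ge0| |by rewrite lerDl].
  apply: ge1r_powR; first by rewrite s0.
  by move: p_ge2; lra.
pose c := s * (k / 2).
have c0 : 0 < c by rewrite mulr_gt0 // divr_gt0.
exists c, (C2 / nu); split => // Z xZ.
pose n := #|` Z|.
pose w : 'rV[R]_n := rst x3 Z (fun y => s * delta x3 y).
have w_en : fenergy x3 w <= - c.
  rewrite -[w]scale1r /fenergy ext_delta // mul1r energy_delta ?(ltW s0) //.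
  have H1 : s `^ p * (p^-1 * psum (tdens (delta x3)) (closed_nb Z)) <= p^-1 * (s `^ p * D).
    rewrite mulrCA ler_wpM2l ?invr_ge0 ?(ltW p_gt0) // ler_wpM2l ?powR_ge0 //.
    exact: delta_norm_le.
  have H2 : 0 <= F x3 s * m x3 by rewrite mulr_ge0 ?c4 // ltW.
  have H3 : p^-1 * (s `^ p * D) <= s * (k / 2).
    apply: (@le_trans _ _ (p^-1 * (s * (k * p / 2)))).
      rewrite ler_wpM2l ?invr_ge0 ?(ltW p_gt0) //; apply: (le_trans spD).
      rewrite ler_wpM2l ?(ltW s0) //; apply: (le_trans (ltW sB)).
      by rewrite /B ge_min lexx orbT.
    by rewrite le_eqVlt; apply/orP; left; apply/eqP; field; rewrite gt_eqF.
  have E4 : eps * (e x3 * s) * m x3 = 2 * (s * (k / 2)) by rewrite /k; field.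
  rewrite E4 /c; lra.
have w_norm : fnorm x3 w <= r0 `^ p.
  rewrite -[w]scale1r /fnorm ext_delta // mul1r.
  have -> : psum (tdens (fun y => s * delta x3 y)) (closed_nb Z) =
      s `^ p * psum (tdens (delta x3)) (closed_nb Z).
    rewrite -psumZ; apply: eq_bigr => y _.
    by rewrite /tdens densZ (gtr0_norm s0) mulrA.
  apply: (@le_trans _ _ (s `^ p * D)).
    by rewrite ler_wpM2l ?powR_ge0 // delta_norm_le.
  apply: (le_trans spD); apply: (@le_trans _ _ (s * (D + 1))).
    by rewrite ler_piMl // mulr_ge0 ?(ltW s0) ?(ltW D1_gt0).
  by apply: (le_trans (ltW sB)); rewrite /B ge_min lexx.
pose A' := [set r : 'rV[R]_n | fnorm x3 r <= r0 `^ p].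
have coA : compact A'.
  apply: bounded_closed_compact.
    exists (1 + (h0 * mu0)^-1 * r0 `^ p); split; first exact: num_real.
    by move=> K HK r /= /fnorm_bounded Hr; apply: le_trans Hr (ltW HK).
  apply: (@closed_comp _ _ (@fnorm x3 Z) [set x | x <= r0 `^ p]); last exact: closed_le.
  by move=> r _; exact: fnorm_continuous.
have [|r0' rA rmin] := EVT_min_rV (ex_intro _ w w_norm) coA (f := @fenergy x3 Z).
  by apply: continuous_subspaceT; exact: fenergy_continuous.
have {}rA : A' r0' := set_mem rA.
have r_en : fenergy x3 r0' <= - c by apply: le_trans w_en; exact: rmin (mem_set w_norm).
(* On the sphere the energy would be at least [al > 0]. Being interior, the minimizer can be moved
   both ways along each coordinate, so every partial derivative vanishes. *)
have r_lt : fnorm x3 r0' < r0 `^ p.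
  rewrite lt_neqAle rA andbT; apply/eqP => nr.
  have := Hal _ Z (@ext_supp x3 Z r0') nr; rewrite -/(fenergy _ _) => H.
  by move: (le_trans H r_en); rewrite leNgt => /negP; apply; rewrite (lt_trans _ al0) // oppr_lt0.
have g0 : fgrad x3 r0' = 0.
  apply/rowP => i; rewrite [RHS]mxE.
  pose d : 'rV[R]_n := delta_mx ord0 i.
  have cl : continuous (fun t : R => r0' + t *: d).
    by move=> t; apply: cvgD; [exact: cvg_cst|exact: scalel_continuous].
  have : \forall t \near (0 : R), fnorm x3 (r0' + t *: d) < r0 `^ p.
    have ct : {for (0 : R), continuous (fun t : R => fnorm x3 (r0' + t *: d))}.
      by apply: (@continuous_comp _ _ _ (fun t : R => r0' + t *: d) (@fnorm x3 Z));
        [exact: cl|exact: fnorm_continuous].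
    by apply: (cvgr_lt _ ct); rewrite scale0r addr0.
  move=> /nbhs_ballP[z /= z0 Hz].
  have zin t : t \in `](- z), z[ -> fnorm x3 (r0' + t *: d) < r0 `^ p.
    rewrite in_itv /= => /andP[t1 t2]; apply: Hz.
    by rewrite -ball_normE /= sub0r normrN ltr_norml t1.
  have dk (t : R) := is_derive_fenergy x3 r0' d t.
  have dk0 : is_derive (0 : R) 1 (fun t : R => fenergy x3 (r0' + t *: d)) 0.
    apply: (@derive1_at_min R _ (- z) z 0).
    - by rewrite ge0_cp // ltW.
    - by move=> t _; have [] := dk t.
    - by rewrite in_itv /= oppr_lt0 z0.
    - move=> t /zin tz; rewrite scale0r addr0; apply: rmin; apply: mem_set.
      exact: ltW.
  have [_ E1] := dk 0; have [_ E2] := dk0.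
  have di : d ord0 i = 1 by rewrite /d mxE !eqxx.
  have dj j : j != i -> d ord0 j = 0 by move=> ji; rewrite /d mxE (negbTE ji) andbF.
  move: E1; rewrite E2 scale0r addr0 (bigD1 i) //= di mulr1 big1 ?addr0 => [<- //|j ji].
  by rewrite dj // mulr0.
exists (ext x3 r0'); split.
- by move=> x; exact: ext_supp.
- exact: fgrad_eq0.
- rewrite -/(fenergy x3 r0') r_en andbT lerNl ler_pdivlMr // mulrC mulrN.
  have := AR (ext x3 r0') Z (@ext_supp x3 Z r0').
  rewrite psum_res_ext -/(fnorm _ _) -/(fenergy _ _) g0.
  rewrite big1; last by move=> i _; rewrite mxE mul0r.
  have := mulr_ge0 (ltW kappa_gt0) (fnorm_ge0 x3 r0').
  lra.
Qed.

(** * Passage from the finite sets to the whole graph *)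

Section Limit.
Variables (c_ C_ : R) (us : {fset V} -> V -> R) (Zs : {fset V} -> {fset V}).
Hypothesis Zs_sub : forall S, (S `<=` Zs S)%fset.
Hypothesis us_supp : forall S x, x \notin Zs S -> us S x = 0.
Hypothesis us_res : forall S x, x \in Zs S -> res (us S) x = 0.
Hypothesis us_energy : forall S, c_ <= psum (edens (us S)) (closed_nb (Zs S)) <= C_.

Let tnorm S := psum (tdens (us S)) (closed_nb (Zs S)).

Lemma tnorm_sum S : has_sum (tdens (us S)) (tnorm S).
Proof. by apply: has_sum_fin => x xZ; apply: tdens_supp xZ => // y; exact: us_supp. Qed.

Lemma us_bounded : exists2 T0, 0 <= T0 & forall S S', psum (tdens (us S)) S' <= T0.
Proof.
have [C2 C20 AR] := ar_bound.
have nu0 : 0 < nu by apply: lt_trans nu_gt.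
have H S : tnorm S <= kappa^-1 * (nu * C_ + C2).
  rewrite ler_pdivlMl ?kappa_gt0 //; apply: le_trans (AR _ _ (@us_supp S)) _.
  rewrite [psum (fun x => res _ _ * _ * _) _]big1_seq ?subr0; last first.
    by move=> x /andP[_ xZ]; rewrite us_res // !mul0r.
  by rewrite lerD2r ler_wpM2l ?(ltW nu0) //; have /andP[] := us_energy S.
have T0 S S' : psum (tdens (us S)) S' <= tnorm S by exact: (psum_le_sum S' (tdens0 (us S)) (@tnorm_sum S)).
exists (kappa^-1 * (nu * C_ + C2)) => [|S S'].
  by apply: le_trans (H fset0); exact: psum_ge0.
exact: le_trans (T0 S S') (H S).
Qed.

Lemma us_sup_bounded : exists2 K0, 0 <= K0 & forall S x, `|us S x| <= K0.
Proof.
have [T0 T00 HT] := us_bounded.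
exists (1 + (h0 * mu0)^-1 * T0).
  by rewrite addr_ge0 // mulr_ge0 // invr_ge0 mulr_ge0 // ltW.
move=> S x; apply: le_trans (le1_add_powR (normr_ge0 _) (ltW p_gt1)) _.
rewrite lerD2l; exact: (u_le_tdens (HT S [fset x]%fset) (fset11 x)).
Qed.

(** All values lie in one compact interval, so an ultrafilter makes them converge at every vertex at
    once. Since it refines [fin_filter], any given vertex is eventually in the support set, where
    the equation holds. *)
Lemma ultra_limit : exists (U : set_system {fset V}) (u : V -> R),
  [/\ ProperFilter U, @fin_filter V `<=` U & forall x, us S x @[S --> U] --> u x].
Proof.
have [K0 K00 HK] := us_sup_bounded.
have [U [UU finU]] := ultraFilterLemma (@fin_filter_proper V).
have ex x : exists l : R, us S x @[S --> U] --> l.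
  have [|l [_ cl]] := @segment_compact R (- K0) K0 (us S x @[S --> U]).
    have H S : `[- K0, K0]%classic (us S x) by rewrite /= in_itv /= -ler_norml; exact: HK.
    exact: (@filterS _ U _ setT _ (fun S _ => H S) filterT).
  (* A cluster point along an ultrafilter is a limit: otherwise the complement of the preimage of a
     neighbourhood would belong to [U], against clustering. *)
  exists l => B nB; have [//|nUB] := in_ultra_setVsetC ((fun S => us S x) @^-1` B) UU.
  by have [y [yB yB']] := cl (~` B) B nUB nB.
exists U, (fun x => projT1 (cid (ex x))); split => //.
- exact: ultra_proper.
- by move=> x; exact: (projT2 (cid (ex x))).
Qed.

Lemma tnormE S : tnorm S = psum (fun x => dF F x (us S x) * us S x * m x) (Zs S) +
  eps * psum (fun x => e x * us S x * m x) (Zs S).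
Proof.
have := psum_res (us S) (@us_supp S).
rewrite [LHS]big1_seq; last by move=> x /andP[_ xZ]; rewrite us_res // !mul0r.
have -> : psum (fun x => bil (us S) (us S) x * m x) (closed_nb (Zs S)) = tnorm S.
  by apply: eq_bigr => x _; rewrite bilxx.
lra.
Qed.

Lemma energyE S : psum (edens (us S)) (closed_nb (Zs S)) = p^-1 * tnorm S -
  psum (fun x => F x (us S x) * m x) (Zs S) - eps * psum (fun x => e x * us S x * m x) (Zs S).
Proof.
rewrite -(psum_extend (sub_closed_nb G (Zs S)) (f := fun x => F x (us S x) * m x)); last first.
  by move=> x /us_supp ->; rewrite F0 mul0r.
rewrite -(psum_extend (sub_closed_nb G (Zs S)) (f := fun x => e x * us S x * m x)); last first.
  by move=> x /us_supp ->; rewrite mulr0 mul0r.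
rewrite -!psumZ -!psumN -!psumD; apply: eq_bigr => x _.
by rewrite /edens /tdens; ring.
Qed.

Section Passage.
Variables (U : set_system {fset V}) (u : V -> R).
Hypothesis FU : ProperFilter U.
Hypothesis finU : @fin_filter V `<=` U.
Hypothesis cvu : forall x, us S x @[S --> U] --> u x.

Lemma limit_res x : res u x = 0.
Proof.
have H1 := @cvg_res _ U FU us u cvu x.
have H2 : res (us S) x @[S --> U] --> 0.
  apply: cvg_near_cst; apply: finU; exists [fset x]%fset => S.
  rewrite fsub1set => xS; apply: us_res.
  exact: (fsubsetP (Zs_sub S)).
exact: (cvg_unique _ H1 H2).
Qed.

Lemma limit_tdens_bounded : abs_bounded (tdens u).
Proof.
have [T0 _ HT] := us_bounded; exists T0 => S.
have -> : psum (fun x => `|tdens u x|) S = psum (tdens u) S.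
  by apply: eq_bigr => x _; rewrite ger0_norm.
have : psum (tdens (us S')) S @[S' --> U] --> psum (tdens u) S.
  by apply: (cvg_sumr FU) => x; exact: (@cvg_tdens _ _ G p h p_ge2 _ U FU us u cvu x).
by move=> /cvgr_to_le; apply; apply: nearW => S'; exact: HT.
Qed.

Lemma us_has_sum (f : V -> R -> R) : (forall x, f x 0 = 0) ->
  forall S, has_sum (fun x => f x (us S x) * m x) (psum (fun x => f x (us S x) * m x) (Zs S)).
Proof.
by move=> f0 S; apply: has_sum_fin => x xZ; rewrite us_supp // f0 mul0r.
Qed.

Lemma limit_dominated (f : V -> R -> R) :
  (forall x, f x 0 = 0) -> (forall x, f x (us S x) @[S --> U] --> f x (u x)) ->
  (exists2 M, 0 <= M & forall S x, `|f x (us S x)| <= M * b x) ->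
  abs_bounded (fun x => f x (u x) * m x) /\
  exists2 s, has_sum (fun x => f x (u x) * m x) s &
    psum (fun x => f x (us S x) * m x) (Zs S) @[S --> U] --> s.
Proof.
move=> f0 cf [M M0 HM]; have [T0 _ HT] := us_bounded.
apply: (@vitali_sum R V _ U FU (fun S x => f x (us S x) * m x) (fun S => tdens (us S))
  _ _ T0 _ (us_has_sum f0) HT).
  by move=> x; apply: (cvg_mulr_cst FU).
move=> d d0; exists (fun x => M * (b x * m x)); split.
  have [C HC] := b_sum; exists (M * C) => S.
  have -> : psum (fun x => `|M * (b x * m x)|) S = M * psum (fun x => `|b x * m x|) S.
    by rewrite -psumZ; apply: eq_bigr => x _; rewrite normrM (ger0_norm M0).
  by rewrite ler_wpM2l.
move=> S x; rewrite normrM (gtr0_norm (m_gt0 x)).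
apply: (@le_trans _ _ (M * (b x * m x))); first by rewrite mulrA ler_wpM2r // ltW.
by rewrite lerDr mulr_ge0 // ltW.
Qed.

Lemma limit_F : abs_bounded (fun x => F x (u x) * m x) /\
  exists2 s, has_sum (fun x => F x (u x) * m x) s &
    psum (fun x => F x (us S x) * m x) (Zs S) @[S --> U] --> s.
Proof.
apply: limit_dominated => //.
- by move=> x; exact: (@cvg_F _ U FU us u cvu x).
- have [K0 _ HK] := us_sup_bounded; have [M M0 HM] := F_bounded K0.
  by exists M => // S x; have [] := HM x _ (HK S x).
Qed.

Lemma limit_dF : exists2 s, has_sum (fun x => dF F x (u x) * u x * m x) s &
    psum (fun x => dF F x (us S x) * us S x * m x) (Zs S) @[S --> U] --> s.
Proof.
have [x|x||//] := @limit_dominated (fun x s => dF F x s * s).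
- by rewrite mulr0.
- by apply: cvgM => //; exact: (@cvg_dF _ U FU us u cvu x).
- have [K0 K00 HK] := us_sup_bounded; have [M M0 HM] := F_bounded K0.
  exists (M * K0); first by rewrite mulr_ge0.
  move=> S x; rewrite normrM mulrAC.
  by apply: ler_pM => //; have [] := HM x _ (HK S x).
Qed.

Lemma limit_sup : exists2 K0, 0 <= K0 & forall x, `|u x| <= K0.
Proof.
have [K0 K00 HK] := us_sup_bounded; exists K0 => // x.
by apply: (cvgr_to_le (cvg_norm (@cvu x))); apply: nearW => S; exact: HK.
Qed.

Lemma limit_dF_mixed : exists2 s, has_sum (fun x => dF F x (u x) * u x * m x) s &
    psum (fun x => dF F x (u x) * us S x * m x) (Zs S) @[S --> U] --> s.
Proof.
have [x|x||//] := @limit_dominated (fun x s => dF F x (u x) * s).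
- by rewrite mulr0.
- by apply: cvgM => //; exact: cvg_cst.
- have [K0 K00 HK] := us_sup_bounded; have [K1 K10 HK1] := limit_sup.
  have [M M0 HM] := F_bounded K1.
  exists (M * K0); first by rewrite mulr_ge0.
  move=> S x; rewrite normrM mulrAC.
  by apply: ler_pM => //; have [] := HM x _ (HK1 x).
Qed.

(** Young's inequality splits [e u] into an arbitrarily small multiple of the density of [us S] and
    a multiple of [|e|^q], which is summable and does not depend on [S]. *)
Lemma limit_e : abs_bounded (fun x => e x * u x * m x) /\
  exists2 s, has_sum (fun x => e x * u x * m x) s &
    psum (fun x => e x * us S x * m x) (Zs S) @[S --> U] --> s.
Proof.
have [T0 _ HT] := us_bounded.
apply: (@vitali_sum R V _ U FU (fun S x => e x * us S x * m x) (fun S => tdens (us S))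
  _ _ T0 _ (us_has_sum (f := fun x s => e x * s) (fun x => mulr0 _)) HT).
  by move=> x; apply: (cvg_mulr_cst FU); apply: cvgM => //; exact: cvg_cst.
move=> d d0; have [C C0 HC] := young_eps p_gt1 (mulr_gt0 d0 h0_gt0).
exists (fun x => C * (`|e x| `^ q * m x)); split.
  exists (C * E) => S.
  have -> : psum (fun x => `|C * (`|e x| `^ q * m x)|) S = C * psum (fun x => `|e x| `^ q * m x) S.
    rewrite -psumZ; apply: eq_bigr => x _.
    by rewrite ger0_norm // !mulr_ge0 ?powR_ge0 // ltW.
  by rewrite ler_wpM2l // psum_e_le.
move=> S x; rewrite normrM (gtr0_norm (m_gt0 x)) normrM /tdens !mulrA -mulrDl.
rewrite ler_wpM2r ?(ltW (m_gt0 x)) //.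
apply: le_trans (HC _ _ (normr_ge0 (e x)) (normr_ge0 (us S x))) _.
by rewrite lerD2r -mulrA ler_wpM2l ?(ltW d0) //; exact: dens_ge_u.
Qed.

(** The weak form of the limit tested against the approximations. [bil_le] supplies the domination,
    with the summable density of the limit as fixed majorant. *)
Lemma limit_bil : exists2 s, has_sum (tdens u) s &
  psum (fun x => bil u (us S) x * m x) (closed_nb (Zs S)) @[S --> U] --> s.
Proof.
have [T0 _ HT] := us_bounded.
have Hs S : has_sum (fun x => bil u (us S) x * m x)
    (psum (fun x => bil u (us S) x * m x) (closed_nb (Zs S))).
  apply: has_sum_fin => x xZ.
  have ux : us S x = 0.
    by apply: us_supp; apply: contra xZ; exact/fsubsetP/sub_closed_nb.
  rewrite /bil ux !mulr0 addr0 /gdot big1_seq ?mulr0 ?mul0r // => y /andP[_ yx].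
  by rewrite ux (us_supp (closed_nbP Glf xZ yx)) subrr !mulr0.
have [|//|_ [s Hs1 Hs2]] := @vitali_sum R V _ U FU (fun S x => bil u (us S) x * m x)
    (fun S => tdens (us S)) _ (fun x => bil u u x * m x) T0 _ Hs HT.
- move=> x; apply: (cvg_mulr_cst FU).
  by apply: (@cvg_bil _ _ G p h p_ge2 _ U FU (fun=> u) us u u) => // y; exact: cvg_cst.
- move=> d d0; exists (fun x => (d^-1 + d) * tdens u x); split.
    have [C HC] := limit_tdens_bounded; exists ((d^-1 + d) * C) => S.
    have dd : 0 <= d^-1 + d by rewrite addr_ge0 ?invr_ge0 // ltW.
    have -> : psum (fun x => `|(d^-1 + d) * tdens u x|) S =
        (d^-1 + d) * psum (fun x => `|tdens u x|) S.
      by rewrite -psumZ; apply: eq_bigr => x _; rewrite normrM (ger0_norm dd).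
    by rewrite ler_wpM2l.
  move=> S x; rewrite normrM (gtr0_norm (m_gt0 x)) /tdens !mulrA -mulrDl.
  rewrite ler_wpM2r ?(ltW (m_gt0 x)) //; exact: (bil_le G p_ge2 h0_gt0 h_ge).
exists s => //; rewrite (_ : tdens u = fun x => bil u u x * m x) //.
by apply/funext => x; rewrite bilxx.
Qed.

(* Testing the limit equation against [us S] gives the convergence of the norms. *)
Lemma limit_tnorm : exists2 s, has_sum (tdens u) s & tnorm S @[S --> U] --> s.
Proof.
have [s1 Hs1 cv1] := limit_dF; have [s2 Hs2 cv2] := limit_dF_mixed.
have [_ [s3 Hs3 cv3]] := limit_e; have [s4 Hs4 cv4] := limit_bil.
have s12 := has_sum_unique Hs1 Hs2.
have H5 : psum (fun x => bil u (us S) x * m x) (closed_nb (Zs S)) @[S --> U] --> s2 + eps * s3.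
  have -> : (fun S => psum (fun x => bil u (us S) x * m x) (closed_nb (Zs S))) =
    (fun S => psum (fun x => dF F x (u x) * us S x * m x) (Zs S) +
      eps * psum (fun x => e x * us S x * m x) (Zs S)).
    apply/funext => S; have := psum_res u (@us_supp S).
    rewrite [LHS]big1_seq; last by move=> x _; rewrite limit_res !mul0r.
    by lra.
  by apply: cvgD => //; apply: cvgM => //; exact: cvg_cst.
(* The equation of [u] gives the norm of [u] as [s2 + eps * s3]; the equations of the approximations
   give their norms the limit [s1 + eps * s3]. Both [s1] and [s2] are the sum of
   [dF F x (u x) * u x * m x]. *)
exists s4 => //; rewrite (cvg_unique _ cv4 H5) // -s12.
under eq_fun do rewrite tnormE.
by apply: cvgD => //; apply: cvgM => //; exact: cvg_cst.
Qed.

Lemma limit_energy : exists c : R, [/\ c_ <= c, c <= C_ & energy G p h F eps e u = c%:E].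
Proof.
have [s Hs cvs] := limit_tnorm; have [bF [sF HsF cvF]] := limit_F.
have [be [se Hse cve]] := limit_e.
exists (p^-1 * s - sF - eps * se).
have H : psum (edens (us S)) (closed_nb (Zs S)) @[S --> U] --> p^-1 * s - sF - eps * se.
  under eq_fun do rewrite energyE.
  apply: cvgB; last by apply: cvgM => //; exact: cvg_cst.
  by apply: cvgB => //; apply: cvgM => //; exact: cvg_cst.
split.
- by apply: (cvgr_to_ge H); apply: nearW => S; have /andP[] := us_energy S.
- by apply: (cvgr_to_le H); apply: nearW => S; have /andP[] := us_energy S.
have E1 : (fun x => (gradn G u x `^ p + h x * `|u x| `^ p) * m x) = tdens u.
  by apply/funext => x; rewrite /tdens densE.
rewrite /energy (@vint_has_sum _ _ G _ s); last 2 first.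
- by rewrite E1; exact: limit_tdens_bounded.
- by rewrite E1.
by rewrite (vint_has_sum bF HsF) (vint_has_sum be Hse).
Qed.

(* Scheffe's argument: the norms converge, so the tails of [tdens (us S)] are
   small. *)
Lemma limit_strong d : 0 < d -> \forall S \near U,
  forall S', psum (tdens (fun x => us S x - u x)) S' <= d.
Proof.
move=> d0; have [s Hs cvs] := limit_tnorm.
pose K : R := 2 `^ (p / 2) * 2 `^ (p / 2).
have K0 : 0 <= K by rewrite mulr_ge0 ?powR_ge0.
have K1 : 0 < 1 + K * 4 by rewrite ltr_wpDr // mulr_ge0.
(* The difference costs [dl] on [Q]. Outside [Q] it costs [K] times the two tails, [3 * dl] for
   [us S] and [dl] for [u]. *)
pose dl := d / (1 + K * 4).
have dl0 : 0 < dl by rewrite divr_gt0.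
have [Q HQ] := abs_tail limit_tdens_bounded dl0.
have {}HQ Z : [disjoint Q & Z]%fset -> psum (tdens u) Z <= dl.
  by move=> /HQ; apply: le_trans; apply: psum_le => x; exact: ler_norm.
have sQ : s <= psum (tdens u) Q + dl.
  apply: (has_sum_le Hs) => S; rewrite (psum_split _ Q S) lerD //.
    by apply: psum_subset => //; exact: fsubsetIr.
  by apply: HQ; apply/fdisjointP => x xQ; rewrite in_fsetD xQ.
have cv1 : psum (tdens (us S)) Q @[S --> U] --> psum (tdens u) Q.
  by apply: (cvg_sumr FU) => x; exact: (@cvg_tdens _ _ G p h p_ge2 _ U FU us u cvu x).
have cv2 : psum (tdens (fun x => us S x - u x)) Q @[S --> U] --> 0.
  have -> : 0 = psum (tdens (fun x => u x - u x)) Q.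
    rewrite /psum big1 // => x _; rewrite (_ : (fun x => u x - u x) = fun=> 0) ?tdens_cst0 //.
    by apply/funext => y; rewrite subrr.
  apply: (cvg_sumr FU) => x.
  apply: (@cvg_tdens _ _ G p h p_ge2 _ U FU (fun S x => us S x - u x) (fun x => u x - u x)).
  by move=> y; apply: cvgB => //; exact: cvg_cst.
have N1 : \forall S \near U, psum (tdens u) Q - dl <= psum (tdens (us S)) Q.
  by apply: (cvgr_ge _ cv1); rewrite ltrBlDr ltrDl.
have N2 : \forall S \near U, psum (tdens (fun x => us S x - u x)) Q <= dl.
  exact: (cvgr_le _ cv2).
have N3 : \forall S \near U, tnorm S <= s + dl.
  by apply: (cvgr_le _ cvs); rewrite ltrDl.
near=> S.
have M1 : psum (tdens u) Q - dl <= psum (tdens (us S)) Q by near: S.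
have M2 : psum (tdens (fun x => us S x - u x)) Q <= dl by near: S.
have M3 : tnorm S <= s + dl by near: S.
move=> S'; rewrite (psum_split _ Q S').
have L1 : psum (tdens (fun x => us S x - u x)) (S' `&` Q)%fset <= dl.
  by apply: le_trans M2; apply: psum_subset => //; exact: fsubsetIr.
have dj : [disjoint Q & S' `\` Q]%fset.
  by apply/fdisjointP => x xQ; rewrite in_fsetD xQ.
(* One [dl] each: from [tnorm S] to [s], from [s] to the part of [u] on [Q], and from there to the
   part of [us S] on [Q]. *)
have L2 : psum (tdens (us S)) (S' `\` Q)%fset <= 3 * dl.
  have := psum_le_sum (S' `|` Q)%fset (tdens0 (us S)) (@tnorm_sum S).
  rewrite (psum_split _ Q) (fsetIidPr (fsubsetUr _ _)) fsetDUl fsetDv fsetU0.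
  lra.
have L3 : psum (tdens (fun x => us S x - u x)) (S' `\` Q)%fset <= K * (3 * dl + dl).
  apply: (@le_trans _ _ (K * (psum (tdens (us S)) (S' `\` Q)%fset + psum (tdens u) (S' `\` Q)%fset))).
    rewrite -psumD -psumZ; apply: psum_le => x.
    rewrite /tdens -mulrDl mulrA ler_wpM2r ?(ltW (m_gt0 x)) //.
    exact: (densB_le G p_ge2 h0_gt0 h_ge).
  by rewrite ler_wpM2l // lerD // HQ.
have -> : d = dl + K * (3 * dl + dl) by rewrite /dl; field; rewrite gt_eqF.
by rewrite lerD.
Unshelve. all: by end_near. Qed.

(** The completion asks for a sequence, so for each [n] one index is picked from the ultrafilter
    with distance at most [1 / (n + 1)] to [u]. [densB_le] then yields the Cauchy property, and the
    sup bound the pointwise convergence. *)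
Lemma limit_W1p : in_W1p G p u.
Proof.
have ex n : exists S, forall S', psum (tdens (fun x => us S x - u x)) S' <= n.+1%:R^-1.
  have n0 : 0 < n.+1%:R^-1 :> R by rewrite invr_gt0.
  by have [S HS] := filter_ex (limit_strong n0); exists S.
pose Sn n := projT1 (cid (ex n)).
have HSn n S' : psum (tdens (fun x => us (Sn n) x - u x)) S' <= n.+1%:R^-1.
  exact: (projT2 (cid (ex n))).
exists (fun n => us (Sn n)); split.
- move=> n; rewrite /in_Cc; apply: (@sub_finite_set _ _ [set` Zs (Sn n)]) => //.
  by move=> x /= ux; apply: contraNT ux => /us_supp ->.
- move=> d d0.
  pose K : R := 2 `^ (p / 2) * 2 `^ (p / 2).
  have K0 : 0 <= K by rewrite mulr_ge0 ?powR_ge0.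
  (* Compares the norm of W^{1,p} with the weighted one: 1 for the gradient part, [h0^-1] for
     [|w|^p]. *)
  pose c0 : R := 1 + h0^-1.
  have c00 : 0 <= c0 by rewrite addr_ge0 // invr_ge0 ltW.
  have dp0 : 0 < d `^ p by rewrite powR_gt0.
  pose B := c0 * K * 2 + 1.
  have B0 : 0 < B by rewrite ltr_wpDl // !mulr_ge0.
  have [N HN] : exists N : nat, B / d `^ p < N.+1%:R.
    by exists (Num.trunc (B / d `^ p)); exact: truncnS_gt.
  exists N => k n Nk Nn.
  pose w x := us (Sn k) x - us (Sn n) x.
  pose f x := gradn G w x `^ p + `|w x| `^ p.
  have f0 x : 0 <= f x by rewrite addr_ge0 ?powR_ge0.
  have f_le x : f x * m x <= c0 * K * (tdens (fun x => us (Sn k) x - u x) x +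
      tdens (fun x => us (Sn n) x - u x) x).
    rewrite /tdens -mulrDl mulrA ler_wpM2r ?(ltW (m_gt0 x)) //.
    apply: (@le_trans _ _ (c0 * dens w x)); last first.
      rewrite -mulrA ler_wpM2l //.
      have := densB_le G p_ge2 h0_gt0 h_ge (fun x => us (Sn k) x - u x) (fun x => us (Sn n) x - u x) x.
      congr (_ <= _); congr (dens _ _); apply/funext => y; rewrite /w; ring.
    rewrite /c0 mulrDl mul1r lerD //.
      by rewrite densE // lerDl mulr_ge0 ?powR_ge0 // (le_trans (ltW h0_gt0)).
    by rewrite ler_pdivlMl //; exact: dens_ge_u.
  have bnd S' : psum (fun x => f x * m x) S' <= c0 * K * (2 * N.+1%:R^-1).
    apply: le_trans (psum_le S' f_le) _; rewrite psumZ ler_wpM2l ?mulr_ge0 // psumD.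
    have le_inv i : (N <= i)%N -> i.+1%:R^-1 <= N.+1%:R^-1 :> R.
      by move=> Ni; rewrite lef_pV2 ?posrE ?ltr0n // ler_nat.
    rewrite mulr_natl mulr2n; apply: lerD.
      exact: le_trans (HSn k S') (le_inv k Nk).
    exact: le_trans (HSn n S') (le_inv n Nn).
  have fm0 x : 0 <= f x * m x by rewrite mulr_ge0 // ltW.
  have [s Hs] := has_sum_pos_exists fm0 bnd.
  rewrite /W1p_norm (@vint_has_sum _ _ G f s); last 2 first.
  + by exists (c0 * K * (2 * N.+1%:R^-1)) => S'; under eq_fun do rewrite ger0_norm //.
  + exact: Hs.
  rewrite poweR_EFin lte_fin.
  have s0 := has_sum_ge0 fm0 Hs.
  have sd : s < d `^ p.
    apply: le_lt_trans (has_sum_le Hs bnd) _.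
    rewrite mulrA ltr_pdivrMr ?ltr0n //.
    move: HN; rewrite ltr_pdivrMr // mulrC; apply: lt_trans.
    by rewrite /B ltrDl.
  have -> : d = (d `^ p) `^ p^-1 by rewrite -powRrM mulfV ?gt_eqF // powRr1 // ltW.
  by apply: gt0_ltr_powR; rewrite ?nnegrE ?invr_gt0 // ltW.
- move=> x; apply/cvgrPdist_le => d d0.
  have hm : 0 < h0 * mu0 by rewrite mulr_gt0.
  have dp0 : 0 < h0 * mu0 * d `^ p by rewrite mulr_gt0 // powR_gt0.
  exists (Num.trunc (h0 * mu0 * d `^ p)^-1) => // n /= Nn.
  have H1 := @u_le_tdens (fun x => us (Sn n) x - u x) [fset x]%fset x _ (HSn n _) (fset11 x).
  have H2 : `|us (Sn n) x - u x| `^ p <= d `^ p.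
    apply: (le_trans H1); rewrite ler_pdivrMl // invf_ple ?posrE ?ltr0n //.
    apply: ltW; apply: lt_le_trans (truncnS_gt _) _.
    by rewrite ler_nat ltnS.
  rewrite distrC leNgt; apply/negP => H3; move: H2; rewrite leNgt => /negP; apply.
  by apply: gt0_ltr_powR => //; rewrite nnegrE // ltW.
Qed.

Lemma limit_is_solution : is_solution G p h F eps e u.
Proof.
split; last first.
  by move=> x; have /eqP := limit_res x; rewrite /res -addrA -opprD subr_eq0 => /eqP.
split; first exact: limit_W1p.
have [C HC] := limit_tdens_bounded.
have hp0 x : 0 <= h x * `|u x| `^ p * m x.
  by rewrite !mulr_ge0 ?powR_ge0 ?(ltW (m_gt0 x)) // (le_trans (ltW h0_gt0)).
have bnd S : psum (fun x => h x * `|u x| `^ p * m x) S <= C.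
  apply: le_trans (HC S); apply: psum_le => x; apply: le_trans (ler_norm _).
  by rewrite /tdens ler_wpM2r ?(ltW (m_gt0 x)) //; exact: dens_ge_hu.
have [s Hs] := has_sum_pos_exists hp0 bnd.
rewrite (@vint_has_sum _ _ G _ s) ?ltry //.
by exists C => S; under eq_fun do rewrite ger0_norm //.
Qed.

End Passage.

Lemma limit_solution : exists (u : V -> R) (c : R),
  [/\ is_solution G p h F eps e u, energy G p h F eps e u = c%:E & c_ <= c <= C_].
Proof.
have [U [u [FU finU cvu]]] := ultra_limit.
have [c [H1 H2 H3]] := limit_energy FU finU cvu.
exists u, c; split => //; last by rewrite H1.
exact: limit_is_solution FU finU cvu.
Qed.

End Limit.

(** By (c1), [dF F y 0 = 0], so the zero function would leave [eps * e y = 0] in the equation at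
    [y]. *)
Lemma solution_nontrivial u y : is_solution G p h F eps e u -> e y != 0 ->
  exists x, u x != 0.
Proof.
move=> [_ eq_u] ey; apply: contrapT => /forallNP u0.
have {}u0 x : u x = 0 by apply/eqP/negPn/negP; exact: u0.
have dF0 : dF F y 0 = 0.
  apply/eqP; rewrite -normr_le0; apply: le_trans (c1 _ _) _; first by rewrite normr0.
  by rewrite normr0 powR0 ?mulr0 // gt_eqF // subr_gt0.
have := eq_u y; rewrite plaplacianE // big1 => [|z _]; last by rewrite !u0 subrr mulr0.
rewrite !u0 dF0 !mulr0 oppr0 !addr0 add0r => /esym/eqP.
by rewrite mulf_eq0 (gt_eqF eps_gt0) (negbTE ey).
Qed.

(** Critical points are only available on sets containing [x0]; adjoining [x0] to every index [S]
    still exhausts the graph. *)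
Lemma solution_of_critical (x0 : V) (c_ C_ : R) :
  (forall Z, x0 \in Z -> exists u,
    [/\ forall x, x \notin Z -> u x = 0, forall x, x \in Z -> res u x = 0
      & c_ <= psum (edens u) (closed_nb Z) <= C_]) ->
  exists (u : V -> R) (c : R),
  [/\ is_solution G p h F eps e u, energy G p h F eps e u = c%:E & c_ <= c <= C_].
Proof.
move=> H; have H' S := H (x0 |` S)%fset (fset1U1 x0 S).
pose us S := projT1 (cid (H' S)).
have Hus S : [/\ forall x, x \notin (x0 |` S)%fset -> us S x = 0,
    forall x, x \in (x0 |` S)%fset -> res (us S) x = 0
    & c_ <= psum (edens (us S)) (closed_nb (x0 |` S)%fset) <= C_].
  exact: (projT2 (cid (H' S))).
apply: (@limit_solution c_ C_ us (fun S => x0 |` S)%fset) => S.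
- exact: fsubsetU1.
- by have [] := Hus S.
- by have [] := Hus S.
- by have [] := Hus S.
Qed.

End Problem.

Theorem theorem1p5 (R : realType) (V : choiceType) (G : wgraph R V) (mu0 p : R)
    (h : V -> R) (F : V -> R -> R) (e : V -> R)
    (Glf : locally_finite G) (Gconn : graph_connected G)
    (mu0_gt0 : 0 < mu0) (meas_ge : forall x, mu0 <= meas G x)
    (p_ge2 : 2 <= p)
    (e_L : in_L G (p / (p - 1)) e) (e_neq0 : exists x, e x != 0)
    (* (h1) *)
    (h0 : R) (h0_gt0 : 0 < h0) (h_ge : forall x, h0 <= h x)
    (* (h2') *)
    (h2' : forall B : R, 0 < B ->
       (\esum_(x in [set x | (h x <= B)%R]) (meas G x)%:E < +oo)%E)
    (* (f0) *)
    (F_C1 : forall x, (forall s, derivable (F x) s 1) /\ continuous (dF F x))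
    (a : R -> R) (a_cont : {within `[0, +oo[, continuous a})
    (a_ge0 : forall t, 0 <= t -> 0 <= a t)
    (b : V -> R) (b_ge0 : forall x, 0 <= b x) (b_L1 : in_L G 1 b)
    (dF_bound : forall x s, `|dF F x s| <= a `|s| * b x)
    (F_bound : forall x s, `|F x s| <= a `|s| * b x)
    (* (c1) *)
    (F0 : forall x, F x 0 = 0)
    (l0 : R) (l0_gt0 : 0 < l0)
    (c1 : forall x s, `|s| < l0 -> `|dF F x s| <= h0 / (p + 1) * `|s| `^ (p - 1))
    (* (c2) *)
    (l1 : R) (l1_gt0 : 0 < l1) (x2 : V) (e_x2 : 0 < e x2) (M : R)
    (M_gt : (D1 G p x2 + meas G x2 * h x2) / (p * meas G x2) < M)
    (c2 : forall s, l1 < s -> M * s `^ p <= F x2 s)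
    (* (c3) *)
    (nu A : R) (nu_gt : p < nu) (A_ge0 : 0 <= A) (A_lt : A < h0 * (nu / p - 1))
    (c3 : forall x s, nu * F x s - dF F x s * s <= A * `|s| `^ p) :
  forall eps : R, 0 < eps -> eps < epsilon0 G p mu0 h0 l0 e ->
  exists u : V -> R,
    [/\ is_solution G p h F eps e u, exists x, u x != 0
      & (0 < energy G p h F eps e u < +oo)%E] /\
    (* under (c4) *)
    ((exists (l2 beta3 : R) (K3 : V -> R) (x3 : V),
        [/\ 0 < l2, 1 < beta3, 0 < e x3, 0 < K3 x3
          & forall s, 0 < s -> s < l2 -> K3 x3 * `|s| `^ beta3 <= F x3 s]) ->
     exists v : V -> R,
       [/\ is_solution G p h F eps e v, exists x, v x != 0,
           (-oo < energy G p h F eps e v < 0)%E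
         & v <> u]).
Proof.
move=> eps eps0 eps_lt.
have p_gt1 : 1 < p by apply: lt_le_trans p_ge2; rewrite ltr1n.
have p_gt0 : 0 < p by apply: lt_trans p_gt1.
have q0 : 0 < p / (p - 1) by rewrite divr_gt0 // subr_gt0.
have L_fin r (f : V -> R) : 0 < r -> in_L G r f ->
    exists2 s, has_sum (fun x => `|f x| `^ r * meas G x) s &
      vint G (fun x => `|f x| `^ r) = s%:E.
  move=> r0; rewrite /in_L /vnorm => fin.
  apply: vint_finite => [x|]; first exact: powR_ge0.
  (* An infinite integral would have an infinite root, so finiteness of the norm passes to the
     integral. *)
  rewrite ltey; apply: contraTneq fin => ->.
  by rewrite poweRyr ?ltxx // invr_eq0 gt_eqF.
have [E e_sum e_int] := L_fin _ _ q0 e_L.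
have [sb b_sum _] := L_fin _ _ ltr01 b_L1.
have b_bd : abs_bounded (fun x => b x * meas G x).
  exists sb => S; have b0 x : 0 <= `|b x| `^ 1 * meas G x.
    by rewrite mulr_ge0 ?powR_ge0 // ltW // meas_gt0.
  have <- : psum (fun x => `|b x| `^ 1 * meas G x) S = psum (fun x => `|b x * meas G x|) S.
    apply: eq_bigr => x _.
    by rewrite powRr1 // normrM (gtr0_norm (meas_gt0 G x)).
  exact: psum_le_sum b0 b_sum.
move: eps_lt; rewrite /epsilon0 /vnorm e_int poweR_EFin /= => eps_lt.
have [al [C [al0 Hmp]]] := critical_mp Glf mu0_gt0 meas_ge p_ge2 h0_gt0 h_ge F_C1
  a_cont b_ge0 dF_bound F_bound F0 l0_gt0 c1 nu_gt A_ge0 A_lt c3 eps0 e_sum eps_lt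
  l1_gt0 e_x2 M_gt c2.
have [u [c [u_sol u_en /andP[al_c _]]]] := solution_of_critical Glf mu0_gt0 meas_ge p_ge2 h0_gt0 h_ge F_C1
  a_cont b_ge0 b_bd dF_bound F_bound F0 nu_gt A_ge0 A_lt c3 eps0 e_sum Hmp.
have nontriv w : is_solution G p h F eps e w -> exists x, w x != 0.
  have [y ey] := e_neq0; move=> w_sol.
  exact: (solution_nontrivial Glf p_ge2 l0_gt0 c1 eps0 w_sol ey).
have c_gt0 : 0 < c by apply: lt_le_trans al_c.
exists u; split; first by split=> //; [exact: nontriv|rewrite u_en lte_fin c_gt0 ltry].
move=> [l2 [beta3 [K3 [x3 [l2_gt0 _ e_x3 K3_gt0 c4]]]]].
have c4' s : 0 < s -> s < l2 -> 0 <= F x3 s.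
  move=> s0 sl; apply: le_trans (c4 s s0 sl).
  by rewrite mulr_ge0 ?powR_ge0 // ltW.
have [k [C' [k0 Hmin]]] := critical_min Glf mu0_gt0 meas_ge p_ge2 h0_gt0 h_ge F_C1
  F0 l0_gt0 c1 nu_gt A_ge0 A_lt c3 eps0 e_sum eps_lt l2_gt0 e_x3 c4'.
have [v [c' [v_sol v_en /andP[_ c'_k]]]] := solution_of_critical Glf mu0_gt0 meas_ge p_ge2 h0_gt0 h_ge F_C1
  a_cont b_ge0 b_bd dF_bound F_bound F0 nu_gt A_ge0 A_lt c3 eps0 e_sum Hmin.
have c'_lt0 : c' < 0 by apply: le_lt_trans c'_k _; rewrite oppr_lt0.
exists v; split => //; first exact: nontriv.
  by rewrite v_en lte_fin c'_lt0 ltNyr.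
move=> vu; move: c'_lt0 c_gt0; have : (c'%:E = c%:E)%E by rewrite -u_en -v_en vu.
by move=> [->] /lt_trans/[apply]; rewrite ltxx.
Qed.
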